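(* Let $X_n$ be the random variable giving the degree of symmetry $\mathrm{ds}(\lambda)$ of a uniformly random partition $\lambda$ with semiperimeter $n$. Then the sequence $X_n$ has a half-normal limiting distribution; specifically, as $n\to\infty$, $$\frac{X_n}{\sqrt{n}}\stackrel{d}{\to}\mathcal H\left(\frac{1}{2}\right),$$ which has density function $\frac{2\sqrt{2}}{\sqrt{\pi}}e^{-2x^2}$ for $x\ge0$, and $$\mathbb{E} X_n=\sqrt{\frac{n}{2\pi}}+O(1),\qquad \mathbb{V} X_n=\left(\frac{1}{4}-\frac{1}{2\pi}\right)n+O(\sqrt{n}),$$ $$\mathbb{P}(X_n=k)=\frac{2\sqrt{2}}{\sqrt{\pi n}}e^{-2k^2/n}+O((k+1)n^{-3/2})+O(n^{-1})$$ uniformly for all integers $0\le k\le k_0\sqrt{n\log n}$ with $k_0<\frac{1}{2}$.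
   Context: An integer partition is a sequence $\lambda=(\lambda_1,\dots,\lambda_k)$ with $k\ge0$ and $\lambda_1\ge\dots\ge\lambda_k\ge1$. The conjugate $\lambda'$ of $\lambda$ is the partition with parts $\lambda'_i=|\{j:\lambda_j\ge i\}|$ for $1\le i\le\lambda_1$; in particular $\lambda_1'$ is the number of parts of $\lambda$. The degree of symmetry is $\mathrm{ds}(\lambda)=|\{i:\lambda_i=\lambda'_i\}|$ (only indices $i$ for which both $\lambda_i$ and $\lambda_i'$ are defined, i.e. are positive parts, count). The semiperimeter of $\lambda$ is $\mathrm{sp}(\lambda)=\lambda_1+\lambda_1'$. $\mathcal H(\sigma)$ denotes the half-normal distribution with density $\frac{1}{\sigma}\sqrt{\frac{2}{\pi}}\,e^{-x^2/2\sigma^2}$ for $x\ge0$; $\stackrel{d}{\to}$ denotes convergence in distribution; $\mathbb{E}$ and $\mathbb{V}$ denote expected value and variance. *)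

(* Defs.v *)
From HB Require Import structures.
From mathcomp Require Import all_boot all_order all_algebra finmap.
From mathcomp Require Import all_classical all_reals all_analysis.
From mathcomp Require Import measurable_realfun.

Set Implicit Arguments.
Unset Strict Implicit.
Unset Printing Implicit Defensive.

Import Order.TTheory GRing.Theory Num.Theory.
Import numFieldNormedType.Exports.

Local Open Scope fset_scope.
Local Open Scope classical_set_scope.
Local Open Scope ring_scope.

Definition is_intpart (s : seq nat) : bool := sorted geq s && all (leq 1) s.

Record intpart := IntPart { parts :> seq nat ; _ : is_intpart parts }.

HB.instance Definition _ := [isSub for parts].
HB.instance Definition _ := [Countable of intpart by <:].

Definition intpart0 : intpart := @IntPart [::] isT.

Section conjugate.
Local Open Scope nat_scope.

Definition conj_seq (s : seq nat) : seq nat :=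
  [seq count (leq i) s | i <- iota 1 (head 0 s)].

Lemma is_intpart_conj (s : seq nat) : is_intpart s -> is_intpart (conj_seq s).
Proof.
move=> /andP[_ _]; apply/andP; split.
  rewrite /conj_seq sorted_map; apply: sub_sorted (iota_ltn_sorted 1 _) => i j /=.
  by move=> /ltnW ij; apply: sub_count => x /=; exact: leq_trans.
apply/allP => c /mapP[i]; rewrite mem_iota add1n ltnS => /andP[i1 is0] ->.
by case: s is0 => [|a s] /= ia; [rewrite leqNgt i1 in ia | rewrite ia].
Qed.

Definition conj_part (l : intpart) : intpart :=
  IntPart (is_intpart_conj (valP l)).

(* Indices are shifted: [i] stands for the (i+1)-st part, and only indices at
   which both a part of [l] and a part of its conjugate exist are counted. *)
Definition ds (l : intpart) : nat :=
  #|[pred i : 'I_(minn (size l) (size (conj_part l)))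
      | nth 0 l i == nth 0 (conj_part l) i]|.

(* The semiperimeter of the empty partition, left undefined by the formula
   lambda_1 + lambda_1', is 0 here. *)
Definition sp (l : intpart) : nat := head 0 l + head 0 (conj_part l).

Lemma size_sp (l : intpart) : size l <= sp l.
Proof.
case: l => -[|a s] // P; have /andP[_ /= /andP[a0 als]] := P.
apply: leq_trans (leq_addl _ _) => /=.
by case: a a0 {P} => //= a _; move: als; rewrite all_count => /eqP ->.
Qed.

Lemma part_le_sp (l : intpart) x : x \in parts l -> x <= sp l.
Proof.
case: l => -[|a s] // P xl; have /andP[/= srt _] := P.
apply: leq_trans (leq_addr _ _) => /=.
move: xl; rewrite inE => /predU1P[->//|xs].
have tr : transitive geq by move=> y u v /= yu vy; exact: leq_trans vy yu.
by have /allP/(_ _ xs) := order_path_min tr srt.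
Qed.

End conjugate.

HB.instance Definition _ := isPointed.Build intpart intpart0.
HB.instance Definition _ := @isMeasurable.Build default_measure_display
  intpart discrete_measurable discrete_measurable0
  discrete_measurableC discrete_measurableU.

Lemma measurable_intpart (A : set intpart) : measurable A.
Proof. by []. Qed.

Lemma finite_sp n : finite_set [set l : intpart | sp l = n].
Proof.
pose f (t : {bseq n of 'I_n.+1}) : intpart :=
  insubd intpart0 (map val (val t)).
apply: (@sub_finite_set _ _ (range f)); last exact/finite_image/finite_finset.
move=> l /= spl.
have sz : (size (map (@inord n) l) <= n)%N by rewrite size_map -spl size_sp.
exists (Bseq sz) => //; apply: val_inj; rewrite /f /=.
have E : map val (map (@inord n) l) = l.
  rewrite -map_comp -[RHS]map_id; apply/eq_in_map => x xl /=.
  by rewrite inordK // ltnS -spl part_le_sp.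
by rewrite val_insubd E (valP l).
Qed.

(* Uniform distribution on the partitions of semiperimeter [n], for every [n]
   such that there is one (all [n] but 1).  For [n = 1] this is the Dirac mass
   at the empty partition. *)
Definition unif_sp (R : realType) (n : nat) : set intpart -> \bar R :=
  mnormalize (mrestr (@counting intpart R)
                     (measurable_intpart [set l | sp l = n]))
             (dirac intpart0).

HB.instance Definition _ (R : realType) n := Probability.on (@unif_sp R n).

Lemma unif_spE (R : realType) n (A : set intpart) :
  [set l : intpart | sp l = n] !=set0 ->
  unif_sp R n A =
    (#|` fset_set (A `&` [set l | sp l = n])|%:R /
     #|` fset_set [set l : intpart | sp l = n]|%:R)%:E.
Proof.
move=> [l ln]; rewrite /unif_sp /mnormalize /= /mrestr /= setTI /counting.
have fS := finite_sp n; have fAS : finite_set (A `&` [set l | sp l = n]).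
  exact: finite_setIr.
rewrite !asboolT // ifF ?asboolT //.
rewrite orbF eqe pnatr_eq0 cardfs_eq0.
apply/eqP => /(congr1 (fun X : {fset intpart} => l \in X)).
by rewrite in_fset_set // inE mem_set.
Qed.

Definition half_normal_pdf (R : realType) (s x : R) : R :=
  if 0 <= x then s^-1 * Num.sqrt (2 / pi) * expR (- (x ^+ 2 / (2 * s ^+ 2)))
  else 0.

Definition half_normal_prob (R : realType) (s : {posnum R}) : set R -> \bar R :=
  fun A => (\int[lebesgue_measure]_(x in A) (half_normal_pdf s%:num x)%:E)%E.

Section half_normal_probability.
Context (R : realType) (s : {posnum R}).
Notation mu := (@lebesgue_measure R).
Notation pdf := (half_normal_pdf s%:num).

Let pdfE : pdf = (fun x => 2 * normal_pdf 0 s%:num x) \_ `[0, +oo[%classic.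
Proof.
apply/funext => x; rewrite /half_normal_pdf patchE mem_setE in_itv /= andbT.
case: ifP => // _; rewrite normal_pdfE // /normal_peak /normal_fun subr0.
rewrite [RHS]mulrA; congr (_ * expR _); last by rewrite mulNr mulr_natl.
have s0 : 0 < s%:num by [].
rewrite -mulrnAr [in RHS]sqrtrM ?sqr_ge0 // sqrtr_sqr gtr0_norm //.
rewrite invfM mulrCA; congr (_ * _).
have p0 : 0 < pi :> R by exact: pi_gt0.
rewrite -[pi *+ 2]mulr_natl !sqrtrM // sqrtrV ?ltW // invfM mulrA.
have q2 : Num.sqrt 2 * Num.sqrt 2 = 2 :> R by rewrite -expr2 sqr_sqrtr.
by rewrite -[X in _ = X / _ / _]q2 mulfK // gt_eqF // sqrtr_gt0.
Qed.

Lemma half_normal_pdf_ge0 x : 0 <= pdf x.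
Proof.
by rewrite /half_normal_pdf; case: ifP => // _; rewrite !mulr_ge0 ?expR_ge0.
Qed.

Lemma measurable_half_normal_pdf : measurable_fun [set: R] pdf.
Proof.
rewrite pdfE; apply/measurable_restrict => //; apply: measurable_funTS.
by apply: measurable_funM => //; exact: measurable_normal_pdf.
Qed.

Lemma integral_half_normal_pdf : (\int[mu]_x (pdf x)%:E = 1)%E.
Proof.
have -> : (\int[mu]_x (pdf x)%:E =
    \int[mu]_(x in `[0%R, +oo[) (2 * normal_pdf 0 s%:num x)%:E)%E.
  rewrite [RHS]integral_mkcond pdfE; apply: eq_integral => x _.
  by rewrite !patchE; case: ifP.
under eq_integral do rewrite EFinM.
rewrite ge0_integralZl //=; last 2 first.
- by apply/measurable_EFinP/measurable_funTS; exact: measurable_normal_pdf.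
- by move=> x _; rewrite lee_fin normal_pdf_ge0.
rewrite set_itvcy -ge0_symfun_integralT //; first exact: integral_normal_pdf.
- by move=> x; exact: normal_pdf_ge0.
- exact: continuous_normal_pdf.
- by move=> x /=; rewrite !normal_pdfE // /normal_fun !subr0 sqrrN.
Qed.

Let P0 : half_normal_prob s set0 = 0%E.
Proof. by rewrite /half_normal_prob integral_set0. Qed.

Let P_ge0 A : (0 <= half_normal_prob s A)%E.
Proof. by apply: integral_ge0 => x _; rewrite lee_fin half_normal_pdf_ge0. Qed.

Let P_sigma_additive : semi_sigma_additive (half_normal_prob s).
Proof.
move=> /= F mF tF mUF; rewrite /half_normal_prob; apply: cvg_toP.
  apply: ereal_nondecreasing_is_cvgn => m n mn.
  by apply: lee_sum_nneg_natr => // k _ _; exact: P_ge0.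
rewrite ge0_integral_bigcup //=.
- apply: measurable_funTS; apply: measurableT_comp => //.
  exact: measurable_half_normal_pdf.
- by move=> x _; rewrite lee_fin half_normal_pdf_ge0.
Qed.

HB.instance Definition _ := isMeasure.Build _ _ _ (half_normal_prob s)
  P0 P_ge0 P_sigma_additive.

Let P_setT : half_normal_prob s [set: _] = 1%E.
Proof. exact: integral_half_normal_pdf. Qed.

HB.instance Definition _ := @Measure_isProbability.Build _ _ R
  (half_normal_prob s) P_setT.

End half_normal_probability.

Definition cvg_in_distribution (R : realType) (d : nat -> measure_display)
    (T : forall n, measurableType (d n)) (P : forall n, probability (T n) R)
    (X : forall n, {RV (P n) >-> R}) (Q : probability R R) : Prop :=
  forall x : R, {for x, continuous (fun r : R => Q `]-oo, r]%classic)} ->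
    cdf (X n) x @[n --> \oo] --> Q `]-oo, x]%classic.

Definition ds_RV (R : realType) (l : intpart) : R := (ds l)%:R.

HB.instance Definition _ (R : realType) :=
  @isMeasurableFun.Build _ _ intpart R (@ds_RV R)
    (fun _ A _ => measurable_intpart _).

Definition scaled_ds_RV (R : realType) (n : nat) (l : intpart) : R :=
  ds_RV R l / Num.sqrt n%:R.

HB.instance Definition _ (R : realType) n :=
  @isMeasurableFun.Build _ _ intpart R (@scaled_ds_RV R n)
    (fun _ A _ => measurable_intpart _).

(* Main.v *)
Require Import Defs.
From mathcomp Require Import all_boot all_order all_algebra finmap.
From mathcomp Require Import all_classical all_reals all_analysis.
From mathcomp Require Import measurable_realfun ring lra zify.

(* The boundary of a partition of semiperimeter n is a word of n east and north
   steps whose first and last steps are imposed, so there are 2^(n-2) of them.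
   Cutting the boundary at the main diagonal and reflecting one half yields two
   lattice paths from a common point, and the degree of symmetry is the number
   of steps that they share.  The distance between the paths performs a simple
   random walk observed at even times, a shared step being an excursion of
   length 2; whether one path ends before the other only matters once no further
   common step is possible.  Hence X_n is distributed as the number of
   excursions of length 2 of a simple random walk of n - 2 steps, plus 1 if that
   walk ends at 0.

   First-step analysis gives E X_n and E X_n (X_n - 1) in closed form, in terms
   of c_N = binomial(2 N, N) / 4^N with N = floor((n - 2) / 2).  It also shows
   that increasing k by 1 in P(X_n = k) amounts to a geometric averaging which,
   up to second differences, moves the argument m of the walk probabilities
   a_N(m) = P(S_(2N-m) = m) by 2.  As the first and second differences of a_N
   are O(1/N) and O(N^(-3/2)), P(X_n = k) = 2 a_N(2k) + O(k n^(-3/2)) + O(1/n).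
   Finally a_N(m) is compared with c_N exp(-m^2/(2n)) by induction on m, and c_N
   with (pi N)^(-1/2) by Wallis' integrals.  Summing the local law over
   k <= x sqrt(n) gives a Riemann sum of the half-normal density. *)

Set Implicit Arguments.
Unset Strict Implicit.
Unset Printing Implicit Defensive.

Import Order.TTheory GRing.Theory Num.Theory.
Import numFieldNormedType.Exports.

Local Open Scope classical_set_scope.
Local Open Scope ring_scope.

(** * Partitions as boundary words *)

Section BoundaryWords.
Local Open Scope nat_scope.

Implicit Types (w u A B : seq bool) (s t : seq nat).

(* A word is read along the boundary from the bottom left to the top right
   corner of the diagram, with [true] for an east and [false] for a north
   step. *)
Fixpoint rows w : seq nat :=
  match w with
  | [::] => [::]
  | true :: w' => map S (rows w')
  | false :: w' => rcons (rows w') 0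
  end.

Fixpoint cols w : seq nat :=
  match w with
  | [::] => [::]
  | true :: w' => count negb w' :: cols w'
  | false :: w' => cols w'
  end.

Lemma size_rows w : size (rows w) = count negb w.
Proof. by elim: w => //= -[] w IH; rewrite ?size_map ?size_rcons IH. Qed.

Lemma rows_sorted w : sorted geq (rows w).
Proof.
elim: w => //= -[] w IH.
  by rewrite sorted_map; apply: sub_sorted IH => i j /=.
by case: (rows w) IH => //= a s sP; rewrite rcons_path sP.
Qed.

Lemma rows_rcons_neq0 u : rows (rcons u false) != [::].
Proof. by rewrite -size_eq0 size_rows -cats1 count_cat addn1. Qed.

Lemma head_rows u : head 0 (rows (rcons u false)) = count id u.
Proof.
elim: u => //= -[] u /=; have := rows_rcons_neq0 u;
  by case: (rows _) => //= a s _ ->.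
Qed.

(** The final north step makes the first row count all the east steps, so [conj_seq] lists every
    column; a trailing east step would add an empty column to [cols]. *)
Lemma conj_rows u : conj_seq (rows (rcons u false)) = cols (rcons u false).
Proof.
elim: u => //= -[] u IH /=.
  have := rows_rcons_neq0 u; rewrite -IH -size_rows.
  case: (rows _) => // a s _; rewrite /conj_seq [head _ _]/= [iota _ _]/=.
  rewrite map_cons; congr (_ :: _).
    by rewrite count_map -[RHS](count_predT (a :: s)); apply: eq_count.
  rewrite -[2]/(1 + 1) iotaDl -map_comp; apply: eq_map => i /=.
  by rewrite count_map; congr (_ + _); apply: eq_count => j /=.
rewrite -IH; have := rows_rcons_neq0 u.
case: (rows _) => // a s _; rewrite /conj_seq /=.
apply/eq_in_map => i; rewrite mem_iota => /andP[i0 _].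
by rewrite -cats1 count_cat /= (leqNgt i 0) i0 !addn0.
Qed.

Lemma is_intpart_word w : is_intpart (rows (true :: rcons w false)).
Proof.
apply/andP; split; first exact: rows_sorted.
by rewrite /= all_map; apply/allP.
Qed.

Definition part_of_word w : intpart := IntPart (is_intpart_word w).

Lemma sp_part_of_word w : sp (part_of_word w) = (size w).+2.
Proof.
rewrite /sp [X in head _ (parts X)]/part_of_word.
have -> : parts (conj_part (part_of_word w)) = cols (true :: rcons w false).
  exact: (conj_rows (true :: w)).
have -> : head 0 (part_of_word w) = (count id w).+1.
  exact: (head_rows (true :: w)).
by rewrite /= -cats1 count_cat /= addn1 addSn addnS -(count_predC id w).
Qed.

(** The first letter can be read off: a leading north step puts a last part 0, a leading east step
    makes all parts positive. *)
Lemma rows_inj u v : rows (rcons u false) = rows (rcons v false) -> u = v.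
Proof.
have N0 x s : map S s <> rcons x 0.
  move=> E; have : 0 \in rcons x 0 by rewrite mem_rcons inE.
  by rewrite -E => /mapP[].
elim: u v => [|[] u IH] [|[] v] //=.
- by move=> /esym/(N0 [::]).
- rewrite -[[:: 0]]/(rcons [::] 0) => /rcons_inj[] /esym/eqP.
  by rewrite (negbTE (rows_rcons_neq0 v)).
- by move=> /(N0 [::]).
- by move=> /(inj_map succn_inj)/IH ->.
- by move=> /N0.
- rewrite -[[:: 0]]/(rcons [::] 0) => /rcons_inj[] /eqP.
  by rewrite (negbTE (rows_rcons_neq0 u)).
- by move=> /esym/N0.
- by move=> /rcons_inj[] /IH ->.
Qed.

Lemma rows_surj s : sorted geq s -> s != [::] ->
  exists u, s = rows (rcons u false).
Proof.
(* This measure decreases both when a last part 0 is removed (north step) and when 1 is subtracted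
   from every part (east step). *)
have [n] := ubnP (size s + sumn s); elim: n s => // n IH s.
case/lastP: s => // s x; rewrite size_rcons sumn_rcons ltnS => sn srt _.
have tr : transitive geq by move=> a b c /= ab bc; exact: leq_trans bc ab.
case: x => [|x] in sn srt *.
  have [->|s0] := eqVneq s [::]; first by exists [::].
  have [|||u E] := IH s; last by exists (false :: u); rewrite /= -E.
  - by lia.
  - by rewrite -cats1 in srt; case/cat_sorted2: srt.
  - by [].
have pos y : y \in rcons s x.+1 -> 0 < y.
  rewrite mem_rcons inE => /predU1P[->//|ys].
  move: srt; rewrite -rev_sorted rev_rcons /= => /(order_path_min _).
  have tr' : transitive (fun x0 y0 => geq y0 x0).
    by move=> a b c /= ab bc; exact: leq_trans ab bc.
  move=> /(_ tr')/allP/(_ y); rewrite mem_rev => /(_ ys) /=.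
  exact: leq_trans.
have E : rcons s x.+1 = map S (map predn (rcons s x.+1)).
  rewrite -map_comp -[LHS]map_id; apply/eq_in_map => y /pos /=.
  by move=> /prednK ->.
have [|||u Eu] := IH (map predn (rcons s x.+1)).
- rewrite size_map size_rcons.
  have : sumn (map predn (rcons s x.+1)) < sumn (rcons s x.+1).
    rewrite map_rcons !sumn_rcons /= addnS ltnS leq_add2r.
    by elim: (s) => //= a l IHl; apply: leq_add; rewrite ?leq_pred.
  by rewrite sumn_rcons; lia.
- by rewrite sorted_map; apply: sub_sorted srt => i j /=; lia.
- by case: (s).
by exists (true :: u); rewrite /= -Eu.
Qed.

Lemma part_of_word_inj : injective part_of_word.
Proof.
move=> u v /(congr1 parts) /= /(inj_map succn_inj).
exact: rows_inj.
Qed.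

Lemma part_of_word_surj (l : intpart) : 1 < sp l ->
  exists w, l = part_of_word w.
Proof.
case: l => s sP sp1; have s0 : s != [::] by case: s sP sp1.
have /andP[srt /allP pos] := sP.
have E : s = map S (map predn s).
  rewrite -map_comp -[LHS]map_id; apply/eq_in_map => y /pos /=.
  by move=> /prednK ->.
have [||u Eu] := @rows_surj (map predn s).
- by rewrite sorted_map; apply: sub_sorted srt => i j /=; lia.
- by case: (s) s0.
by exists u; apply: val_inj; rewrite /= -Eu.
Qed.

End BoundaryWords.

(** * The degree of symmetry as a number of common steps *)

Section CommonSteps.
Local Open Scope nat_scope.

Implicit Types (w u A B : seq bool) (s t : seq nat).

(* The boundary is cut where it meets the main diagonal; after reflecting one
   of the two halves, both start at the same point, and [true] denotes a step
   towards the left side of the diagram.  [col_values] lists the heights of the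
   columns ended by the steps [true], [row_values] the lengths of the rows
   ended by the steps [false]. *)
Fixpoint col_values y A : seq nat :=
  match A with
  | [::] => [::]
  | true :: A' => y :: col_values y A'
  | false :: A' => col_values y.+1 A'
  end.

Fixpoint row_values x A : seq nat :=
  match A with
  | [::] => [::]
  | true :: A' => row_values x.-1 A'
  | false :: A' => x :: row_values x A'
  end.

Definition agreements s t := count (fun p => p.1 == p.2) (zip s t).

(* The number of steps shared by two paths that have already made [p] and [q]
   steps [true] in the same total number of steps. *)
Fixpoint common p q A B : nat :=
  match A, B with
  | a :: A', b :: B' => ((p == q) && (a == b)) + common (p + a) (q + b) A' B'
  | _, _ => 0
  end.

Lemma size_col_values y A : size (col_values y A) = count id A.
Proof. by elim: A y => //= -[] A IH y /=; rewrite ?IH. Qed.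

Lemma rows_rev_cat A u : rows (rev A ++ u) =
  map (addn (count id A)) (rows u) ++ row_values (count id A) A.
Proof.
elim: A u => [|[] A IH] u /=.
- by rewrite cats0 map_id.
- rewrite rev_cons cat_rcons IH /= -map_comp; congr (_ ++ _).
  by apply: eq_map => i /=; rewrite addnS.
- by rewrite rev_cons cat_rcons IH /= map_rcons cat_rcons addn0.
Qed.

Lemma rows_negb B : rows (map negb B) = rev (col_values 0 B).
Proof.
have shift y A : col_values y.+1 A = map S (col_values y A).
  by elim: A y => //= -[] A IH y /=; rewrite ?IH.
by elim: B => //= -[] B IH /=; rewrite IH ?rev_cons // shift map_rev.
Qed.

Lemma cols_rev_cat A u :
  cols (rev A ++ u) = rev (col_values (count negb u) A) ++ cols u.
Proof.
elim: A u => [|[] A IH] u //=; rewrite rev_cons cat_rcons IH //=.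
by rewrite rev_cons cat_rcons.
Qed.

Lemma cols_negb B : cols (map negb B) = row_values (count id B) B.
Proof.
elim: B => //= -[] B IH //=; rewrite IH; congr (_ :: _).
by rewrite count_map; apply: eq_count; case.
Qed.

Lemma col_values_addn y x A :
  map (addn x) (col_values y A) = col_values (x + y) A.
Proof. by elim: A y => //= -[] A IH y /=; rewrite IH ?addnS. Qed.

Lemma agreements_nth s t :
  count (fun i => nth 0 s i == nth 0 t i) (iota 0 (minn (size s) (size t)))
  = agreements s t.
Proof.
rewrite /agreements; elim: s t => [|a s IH] [|b t] //=.
rewrite minnSS /=; congr (_ + _); rewrite -IH -[1]/(1 + 0) iotaDl count_map.
by apply: eq_count => i /=.
Qed.

Lemma agreements_cat s1 s2 t1 t2 : size s1 = size t1 ->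
  agreements (s1 ++ s2) (t1 ++ t2) = agreements s1 t1 + agreements s2 t2.
Proof. by move=> E; rewrite /agreements zip_cat // count_cat. Qed.

Lemma agreements_rev s t : size s = size t ->
  agreements (rev s) (rev t) = agreements s t.
Proof. by move=> E; rewrite /agreements -rev_zip // count_rev. Qed.

Lemma agreementsC s t : agreements s t = agreements t s.
Proof.
rewrite /agreements; elim: s t => [|a s IH] [|b t] //=.
by rewrite IH eq_sym.
Qed.

Lemma agreements0s t : agreements [::] t = 0.
Proof. by case: t. Qed.

Lemma agreementss0 s : agreements s [::] = 0.
Proof. by case: s. Qed.

Lemma agreements_lt y s t d : all (ltn y) t ->
  agreements (y :: s) (drop d t) = agreements s (drop d.+1 t).
Proof.
elim: t d => [|b t IH] d; first by case: s.
move=> /= /andP[yb al]; case: d => [|d] /=; last exact: IH.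
by rewrite drop0 /agreements /= ltn_eqF.
Qed.

Lemma agreements_gt x s t d : all (gtn x) s ->
  agreements (drop d s) (x :: t) = agreements (drop d.+1 s) t.
Proof.
elim: s d => [|a s IH] d; first by case: d; case: t.
move=> /= /andP[xa al]; case: d => [|d] /=; last exact: IH.
by rewrite drop0 /agreements /= ltn_eqF.
Qed.

Lemma col_values_ge y A : all (leq y) (col_values y A).
Proof.
elim: A y => //= -[] A IH y /=; rewrite ?leqnn ?IH //.
by apply: sub_all (IH y.+1) => i /ltnW.
Qed.

Lemma row_values_le x A : all (geq x) (row_values x A).
Proof.
elim: A x => //= -[] A IH x /=; rewrite ?leqnn ?IH //.
by apply: sub_all (IH x.-1) => i /= /leq_trans; apply; exact: leq_pred.
Qed.

Lemma commonC p q A B : common p q A B = common q p B A.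
Proof.
elim: A p q B => [|a A IH] p q [|b B] //=.
by rewrite IH !(eq_sym q, eq_sym b).
Qed.

Lemma commonS p q A B : common p.+1 q.+1 A B = common p q A B.
Proof.
by elim: A p q B => [|a A IH] p q [|b B] //=; rewrite !addSn IH eqSS.
Qed.

(* [d] is the horizontal distance between the two current points; the columns
   (resp. rows) still to be ended by both paths are aligned by dropping [d]
   entries. *)
Lemma agreements_common d x y A B : count id A = x -> count id B = d + x ->
  agreements (col_values y A) (drop d (col_values (y + d) B))
    + agreements (drop d (row_values x A)) (row_values (d + x) B)
  = common d 0 A B.
Proof.
have [n] := ubnP (size A + size B).
elim: n d x y A B => // n IH d x y [|a A] [|b B] //=; rewrite ?ltnS.
- by move=> _ _ _; rewrite !agreements0s.
- by move=> _ _ _; rewrite !agreementss0.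
rewrite addnS => sz; have {}sz := ltnW sz; case: a b => -[] /=.
- case: x => // x [Ax]; rewrite addnS => -[Bx].
  rewrite add0n in Ax; rewrite add0n in Bx.
  rewrite addnS addn0 addn1 !succnK commonS eqxx andbT -(IH d x y) //.
  case: d => [|d] in Bx *; rewrite ?addn0 ?drop0.
    by rewrite /agreements /= eqxx addnA.
  rewrite [drop d.+1 (_ :: _)]/= agreements_lt //.
  by apply: sub_all (col_values_ge _ _) => i; apply: leq_trans; lia.
- case: x => // x [Ax]; rewrite add0n => Bx; rewrite add0n in Ax.
  rewrite andbF !add0n addn1 -(IH d.+1 x y) //; last first.
    by rewrite Bx addnS addSn.
  rewrite (addnS y) (addnS d) -addSn agreements_lt; last first.
    by apply: sub_all (col_values_ge _ _) => i; apply: leq_trans; lia.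
  rewrite agreements_gt //.
  by apply: sub_all (row_values_le _ _) => i /= /leq_ltn_trans; apply; lia.
- rewrite add0n => Ax Bx; rewrite andbF !add0n addn0.
  case: d => [|d] in Bx *; last first.
    rewrite commonS -(IH d x y.+1) //; last by move: Bx; rewrite addSn => -[].
    by rewrite addnS [drop d.+1 (_ :: _)]/= [in RHS]addSn.
  rewrite addn0 !drop0 add0n in Bx *.
  rewrite -Bx in Ax *; 
  (* From distance 0, [B] gets ahead of [A] in steps [true]; the induction hypothesis is applied
     with the two paths exchanged. *)
  rewrite commonC -(IH 1 (count id B) y B A) //; last first.
    by rewrite addnC.
  rewrite add1n addn1 succnK; congr (_ + _).
    by rewrite -(@agreements_lt y _ _ 0) ?col_values_ge // drop0 agreementsC.
  rewrite -(@agreements_gt (count id B).+1 _ _ 0) ?drop0 1?agreementsC //.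
  exact: row_values_le.
- rewrite !add0n => Ax Bx; rewrite andbT !addn0 -(IH d x y.+1) //.
  case: d => [|d] in Bx *; rewrite ?addn0 ?drop0 ?addSn.
    by rewrite /agreements /= add0n eqxx addnCA.
  rewrite [drop d.+1 (_ :: _)]/= agreements_gt //.
  by apply: sub_all (row_values_le _ _) => i /= /leq_ltn_trans; apply; lia.
Qed.

(** Below index [count id A], the side of the Durfee square, rows are ended by steps of [B] and
    columns by steps of [A]; beyond it the roles are exchanged. The agreements of both blocks are
    added up by [agreements_common] at distance 0. *)
Lemma ds_part_of_word A B w : count id A = count id B ->
  true :: rcons w false = rev A ++ map negb B ->
  ds (part_of_word w) = common 0 0 A B.
Proof.
move=> AB E; rewrite /ds.
have -> : parts (conj_part (part_of_word w)) = cols (rev A ++ map negb B).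
  by rewrite -E; exact: (conj_rows (true :: w)).
have -> : parts (part_of_word w) = rows (rev A ++ map negb B) by rewrite -E.
set s := rows _; set t := cols _.
have -> : #|[pred i : 'I_(minn (size s) (size t)) | nth 0 s i == nth 0 t i]|
    = agreements s t.
  rewrite -agreements_nth -sum1_card.
  rewrite (eq_bigl (fun i : 'I__ => nth 0 s i == nth 0 t i)); last first.
    by move=> i; rewrite inE.
  rewrite -(big_mkord (fun i => nth 0 s i == nth 0 t i) (fun=> 1)).
  by rewrite /index_iota subn0 sum1_count.
rewrite /s /t rows_rev_cat cols_rev_cat rows_negb cols_negb.
rewrite map_rev col_values_addn addn0.
have -> : count negb (map negb B) = count id A.
  by rewrite AB count_map; apply: eq_count; case.
rewrite agreements_cat ?size_rev ?size_col_values //.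
rewrite agreements_rev ?size_col_values //.
have := @agreements_common 0 (count id A) (count id A) A B erefl.
by rewrite !drop0 addn0 add0n -AB agreementsC => ->.
Qed.

(* [common] of the two paths completed by their last step, which is always
   [true]. *)
Fixpoint common_end p q A B : nat :=
  match A, B with
  | [::], [::] => p == q
  | a :: A', b :: B' =>
      ((p == q) && (a == b)) + common_end (p + a) (q + b) A' B'
  | _, _ => 0
  end.

(** If one path ends first, its closing step is not shared: the other path either makes a step
    [false] there, or still has a step [true] to make before the common end point and so is
    elsewhere. *)
Lemma common_rcons p q A B : p + count id A = q + count id B ->
  common p q (rcons A true) (rcons B true) = common_end p q A B.
Proof.
elim: A p q B => [|a A IH] p q [|b B] /=; rewrite ?addn0.
- by rewrite eqxx andbT.
- by move=> ->; case: b; rewrite ?andbF // -[X in _ == X]addn0 eqn_add2l.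
- move=> <-; have -> : forall p q, common p q (rcons A true) [::] = 0.
    by case: A {IH}.
  rewrite addn0; case: a; rewrite ?andbF //.
  by rewrite -[X in X == _]addn0 eqn_add2l.
- by rewrite !addnA => /IH ->.
Qed.

Lemma common_endC p q A B : common_end p q A B = common_end q p B A.
Proof.
elim: A p q B => [|a A IH] p q [|b B] //=; first by rewrite eq_sym.
by rewrite IH !(eq_sym q, eq_sym b).
Qed.

Lemma common_endS p q A B : common_end p.+1 q.+1 A B = common_end p q A B.
Proof.
by elim: A p q B => [|a A IH] p q [|b B] //=; rewrite !addSn IH eqSS.
Qed.

(** The closing steps [true] of the two paths are the imposed first and last steps of the
    boundary. *)
Lemma ds_split A B : count id A = count id B ->
  ds (part_of_word (rev A ++ map negb B)) = common_end 0 0 A B.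
Proof.
move=> AB; rewrite -common_rcons ?add0n //.
apply: ds_part_of_word; first by rewrite -!cats1 !count_cat AB.
by rewrite rev_rcons map_rcons rcons_cat.
Qed.

End CommonSteps.

(** * Sums over binary words *)

Section Words.

Fixpoint words n : seq (seq bool) :=
  if n is m.+1 then map (cons true) (words m) ++ map (cons false) (words m)
  else [:: [::]].

Lemma mem_words n w : (w \in words n) = (size w == n).
Proof.
have inj b : injective (cons b : seq bool -> _) by move=> u v [].
elim: n w => [|n IH] w; first by rewrite inE size_eq0.
rewrite mem_cat; case: w => [|b w].
  by apply/orP => -[] /mapP[].
rewrite eqSS -IH; case: b.
  by rewrite mem_map // orbC; case: mapP => //= -[].
by rewrite [X in _ || X]mem_map //; case: mapP => //= -[].
Qed.

Lemma words_uniq n : uniq (words n).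
Proof.
have inj b : injective (cons b : seq bool -> _) by move=> u v [].
elim: n => //= n IH; rewrite cat_uniq !map_inj_uniq // IH andbT /=.
by apply/hasPn => w /mapP[v _ ->]; apply/mapP => -[].
Qed.

Lemma size_words n : size (words n) = (2 ^ n)%N.
Proof.
by elim: n => //= n IH; rewrite size_cat !size_map IH expnS mul2n addnn.
Qed.

Variable V : nmodType.
Implicit Types G : seq bool -> V.

Lemma sum_wordsS n G : \sum_(w <- words n.+1) G w =
  \sum_(w <- words n) (G (true :: w) + G (false :: w)).
Proof. by rewrite big_cat !big_map big_split. Qed.

Lemma sum_words_cat i j G : \sum_(w <- words (i + j)) G w =
  \sum_(u <- words i) \sum_(v <- words j) G (u ++ v).
Proof.
elim: i G => [|i IH] G; first by rewrite big_seq1.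
by rewrite sum_wordsS big_split !IH sum_wordsS big_split.
Qed.

Lemma sum_words_involutive n (f : seq bool -> seq bool) G : involutive f ->
  (forall w, size (f w) = size w) ->
  \sum_(w <- words n) G (f w) = \sum_(w <- words n) G w.
Proof.
move=> fK fsz; rewrite -(big_map f predT); apply: perm_big.
apply: uniq_perm; rewrite ?map_inj_uniq ?words_uniq //; first exact: inv_inj.
move=> w; rewrite -{1}(fK w) mem_map; last exact: inv_inj.
by rewrite !mem_words fsz.
Qed.

(** Each word is cut after as many letters as it has letters [false]: this is the only cut with as
    many [true] before it as [false] after it, that is, on the main diagonal. *)
Lemma sum_words_split n G : \sum_(w <- words n) G w =
  \sum_(i < n.+1) \sum_(A <- words i) \sum_(B <- words (n - i))
    (if count id A == count id B then G (rev A ++ map negb B) else 0).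
Proof.
transitivity (\sum_(i < n.+1) \sum_(w <- words n)
    (if count negb w == i then G w else 0)).
  rewrite exchange_big; rewrite [LHS]big_seq [RHS]big_seq.
  apply: eq_bigr => w; rewrite mem_words => /eqP wn.
  have cn : (count negb w < n.+1)%N by rewrite ltnS -wn count_size.
  rewrite -big_mkcond (big_pred1 (Ordinal cn)) //.
apply: eq_bigr => i _; have ni : (n = i + (n - i))%N.
  by rewrite subnKC // -ltnS.
rewrite {1}ni sum_words_cat -(@sum_words_involutive i rev); last 2 first.
- exact: revK.
- exact: size_rev.
rewrite [LHS]big_seq [RHS]big_seq; apply: eq_bigr => A.
rewrite mem_words => /eqP Ai.
rewrite -(@sum_words_involutive (n - i) (map negb)); last 2 first.
- by apply: mapK => b; rewrite negbK.
- by move=> w; rewrite size_map.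
apply: eq_bigr => B _; congr (if _ then _ else _).
rewrite count_cat count_rev -Ai -(count_predC id A) count_map.
rewrite (@eq_count _ (preim negb negb) id); last by case.
by rewrite addnC eqn_add2r eq_sym.
Qed.

End Words.

(** * First-step analysis *)

Section PairSums.
Variable R : realType.
Implicit Types phi : nat -> R.

Let T i j p q phi : R := \sum_(A <- words i) \sum_(B <- words j)
  (if (p + count id A == q + count id B)%N
   then phi (common_end p q A B) else 0).

Let T_SS i j p q phi : T i.+1 j.+1 p q phi =
  T i j p.+1 q.+1 (fun k => phi ((p == q) + k)%N) + T i j p.+1 q phi
  + T i j p q.+1 phi + T i j p q (fun k => phi ((p == q) + k)%N).
Proof.
rewrite /T sum_wordsS -!big_split /=; apply: eq_bigr => A _.
rewrite !sum_wordsS -!big_split /=; apply: eq_bigr => B _ /=.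
rewrite !andbT !andbF !add0n !addn0 !addn1 !(addnS, addSn).
by rewrite !add0n !addrA.
Qed.

Let T_shift i j p q phi : T i j p.+1 q.+1 phi = T i j p q phi.
Proof.
apply: eq_bigr => A _; apply: eq_bigr => B _.
by rewrite !addSn eqSS common_endS.
Qed.

Let T_swap i j p q phi : T i j p q phi = T j i q p phi.
Proof.
rewrite /T exchange_big; apply: eq_bigr => A _; apply: eq_bigr => B _.
by rewrite eq_sym common_endC.
Qed.

(** When exactly one path is exhausted nothing more is counted, so only [phi 0] contributes; hence
    the condition [phi 0 = 0] in the first-step relations. *)
Let T_0S j p q phi : phi 0%N = 0 -> T 0 j.+1 p q phi = 0.
Proof.
move=> phi0; rewrite /T big_seq1 sum_wordsS big1 // => B _ /=.
by rewrite phi0 !if_same addr0.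
Qed.

Let T_S0 i p q phi : phi 0%N = 0 -> T i.+1 0 p q phi = 0.
Proof. by move=> phi0; rewrite T_swap T_0S. Qed.

Let T_00 p q phi : T 0 0 p q phi = if p == q then phi 1%N else 0.
Proof. by rewrite /T !big_seq1 !addn0 /=; case: eqP. Qed.

(* Pairs of paths whose starting points are at distance [h], with total length
   [L], last steps removed. *)
Definition pair_sum L h phi : R := \sum_(i < L.+1) T i (L - i) h 0 phi.

Lemma sum_ds_words L phi :
  \sum_(w <- words L) phi (ds (part_of_word w)) = pair_sum L 0 phi.
Proof.
rewrite sum_words_split /pair_sum; apply: eq_bigr => i _.
apply: eq_bigr => A _; apply: eq_bigr => B _; rewrite !add0n.
by case: eqP => // /ds_split ->.
Qed.

Lemma pair_sum0 h phi : pair_sum 0 h phi = if h == 0%N then phi 1%N else 0.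
Proof. by rewrite /pair_sum big_ord1 T_00. Qed.

Lemma pair_sum1 h phi : phi 0%N = 0 -> pair_sum 1 h phi = 0.
Proof.
by move=> phi0; rewrite /pair_sum big_ord_recl big_ord1 T_0S // T_S0 // addr0.
Qed.

Let pair_sumSS L h phi : phi 0%N = 0 -> pair_sum L.+2 h phi =
  \sum_(i < L.+1) (T i (L - i) h 0 (fun k => phi ((h == 0) + k)%N)
    + T i (L - i) h.+1 0 phi + T i (L - i) h 1 phi
    + T i (L - i) h 0 (fun k => phi ((h == 0) + k)%N)).
Proof.
move=> phi0; rewrite /pair_sum big_ord_recl T_0S // add0r big_ord_recr /=.
rewrite /bump /= add1n subnn T_S0 // addr0; apply: eq_bigr => i _.
rewrite add1n subSS subSn; last by rewrite -ltnS.
by rewrite T_SS T_shift.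
Qed.

Lemma pair_sum_far L h phi : phi 0%N = 0 -> pair_sum L.+2 h.+1 phi =
  pair_sum L h.+1 phi *+ 2 + pair_sum L h.+2 phi + pair_sum L h phi.
Proof.
move=> phi0; rewrite pair_sumSS // !big_split /= mulr2n /pair_sum.
under [X in _ + _ + X + _]eq_bigr do rewrite T_shift.
by rewrite [LHS]addrC -!addrA.
Qed.

Lemma pair_sum_near L phi : phi 0%N = 0 -> pair_sum L.+2 0 phi =
  pair_sum L 0 (phi \o succn) *+ 2 + pair_sum L 1 phi *+ 2.
Proof.
move=> phi0; rewrite pair_sumSS // !big_split /= !mulr2n /pair_sum.
(* Reversing the split of the total length exchanges the two paths. *)
have -> : \sum_(i < L.+1) T i (L - i) 0 1 phi =
    \sum_(i < L.+1) T i (L - i) 1 0 phi.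
  rewrite [RHS](reindex_inj rev_ord_inj) /=; apply: eq_bigr => i _.
  by rewrite T_swap subSS subKn // -ltnS.
by rewrite [LHS]addrC -!addrA.
Qed.

Lemma pair_sumD L h phi psi :
  pair_sum L h (fun k => phi k + psi k) = pair_sum L h phi + pair_sum L h psi.
Proof.
rewrite -big_split; apply: eq_bigr => i _; rewrite -big_split.
apply: eq_bigr => A _; rewrite -big_split; apply: eq_bigr => B _ /=.
by case: ifP; rewrite ?addr0.
Qed.

Lemma pair_sumZ L h c phi :
  pair_sum L h (fun k => c * phi k) = c * pair_sum L h phi.
Proof.
rewrite mulr_sumr; apply: eq_bigr => i _; rewrite mulr_sumr.
apply: eq_bigr => A _; rewrite mulr_sumr; apply: eq_bigr => B _ /=.
by case: ifP; rewrite ?mulr0.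
Qed.

Lemma pair_sum_total L : pair_sum L 0 (fun=> 1) = 2 ^+ L.
Proof.
rewrite -sum_ds_words big_const_seq count_predT size_words.
by rewrite iter_addr_0 natrX.
Qed.

End PairSums.

(** * Transition probabilities of the simple random walk *)

(* The probability that a simple random walk of even length [2 * N] ends at
   its starting point. *)
Fixpoint central (R : realType) N : R :=
  if N is N'.+1 then central R N' * ((N'.*2.+1)%:R / (N'.*2.+2)%:R) else 1.

(* The probability that a simple random walk of length [2 * M - m] ends at
   distance [m], in a given direction, from its starting point; it vanishes
   for [M < m], the denominator being [0] only from [m' = 2 * M] on. *)
Fixpoint walk (R : realType) M m : R :=
  if m is m'.+1
  then walk R M m' * (2 * (M%:R - m'%:R) / (2 * M%:R - m'%:R))
  else central R M.

Arguments central : simpl never.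
Arguments walk : simpl never.

Section Kernel.
Variable R : realType.
Notation central := (@central R).
Notation walk := (@walk R).

Lemma centralS N : central N.+1 = central N * ((N.*2.+1)%:R / (N.*2.+2)%:R).
Proof. by []. Qed.

Lemma walk0 M : walk M 0 = central M.
Proof. by []. Qed.

Lemma walkS M m :
  walk M m.+1 = walk M m * (2 * (M%:R - m%:R) / (2 * M%:R - m%:R)).
Proof. by []. Qed.

Lemma central0 : central 0 = 1.
Proof. by []. Qed.

Lemma walk01 M : walk M.+1 1 = walk M.+1 0.
Proof.
by rewrite walkS !subr0 divff ?mulr1 // mulf_neq0 ?pnatr_eq0.
Qed.

Lemma walk_gt M m : (M < m)%N -> walk M m = 0.
Proof.
elim: m => // m IH; rewrite ltnS leq_eqVlt walkS => /predU1P[->|/IH ->].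
  by rewrite subrr mulr0 mul0r mulr0.
by rewrite mul0r.
Qed.

Lemma walkSS M m :
  walk M.+1 m.+1 = walk M m * ((2 * M%:R + 1 - m%:R) / (2 * (M%:R + 1))).
Proof.
have M0 : (M%:R + 1 : R) != 0 by rewrite natr1 pnatr_eq0.
elim: m => [|m IH].
  rewrite walk01 !walk0 centralS subr0.
  by congr (_ * (_ / _)); rewrite -!natr1 -mul2n natrM; ring.
have [mM|Mm] := ltnP m M; last first.
  rewrite !walk_gt ?mul0r //.
rewrite walkS (walkS M) IH -!natr1.
have : (m%:R < M%:R :> R) by rewrite ltr_nat.
have := ler0n R m.
move: (m%:R) (M%:R) M0 => x y y0 x0 xy.
field; rewrite y0 /=; apply/andP; split; apply: lt0r_neq0; lra.
Qed.

(** Last-step analysis: a walk of length [2 * M - m + 1] ending at [m + 1] was at [m] or [m + 2] one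
    step before, with probabilities [walk M m] and [walk M.+1 m.+2]. *)
Lemma walk_pascal M m : walk M m = 2 * walk M.+1 m.+1 - walk M.+1 m.+2.
Proof.
have M0 : (M%:R + 1 : R) != 0 by rewrite natr1 pnatr_eq0.
have [mM|Mm] := leqP m M; last by rewrite !walk_gt ?mulr0 ?subr0 // ltnW.
rewrite (walkS M.+1 m.+1) (walkSS M m) -[M.+1%:R]natr1 -[m.+1%:R]natr1.
have : (m%:R <= M%:R :> R) by rewrite ler_nat.
have := ler0n R m.
move: (m%:R) (M%:R) M0 => x y y0 x0 xy.
field; rewrite y0 andbT; apply: lt0r_neq0; lra.
Qed.

Lemma walk_pascal2 M m : walk M.+2 m.+2 =
  2^-1 * walk M.+1 m.+2 + 4^-1 * walk M m + 4^-1 * walk M.+2 m.+4.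
Proof.
have := walk_pascal M m; have := walk_pascal M.+1 m.+1.
have := walk_pascal M.+1 m.+2; lra.
Qed.

(* The probabilities that a simple random walk of length [2 * N] goes from [0]
   to [2 * h], and that it reaches [2 * h] for the first time at its last
   step. *)
Definition transition N h := walk (N + h) h.*2.
Definition passage N h := walk (N + h) h.*2 - walk (N + h) h.*2.+1.

Lemma transition_far N h : transition N.+1 h.+1 =
  2^-1 * transition N h.+1 + 4^-1 * transition N h + 4^-1 * transition N h.+2.
Proof. by rewrite /transition !addnS !addSn !doubleS walk_pascal2. Qed.

Lemma passage_far N h : passage N.+1 h.+1 =
  2^-1 * passage N h.+1 + 4^-1 * passage N h + 4^-1 * passage N h.+2.
Proof.
rewrite /passage !addnS !addSn !doubleS (walk_pascal2 _ h.*2).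
by rewrite (walk_pascal2 _ h.*2.+1); lra.
Qed.

Lemma transition_near N :
  transition N.+1 0 = 2^-1 * transition N 0 + 2^-1 * transition N 1.
Proof.
rewrite /transition !addn0 addn1 [double 1]/=.
have := walk_pascal N 0; rewrite walk01; rewrite [double 0]/=; lra.
Qed.

Lemma transition0S h : transition 0 h.+1 = 0.
Proof. by rewrite /transition walk_gt // add0n -addnn addSn ltnS leq_addl. Qed.

Lemma passage0S h : passage 0 h.+1 = 0.
Proof.
rewrite /passage !walk_gt ?subrr // add0n -addnn addSn ltnS ?leq_addl //.
by rewrite ltnW // ltnS leq_addl.
Qed.

Lemma passageS0 N : passage N.+1 0 = 0.
Proof. by rewrite /passage addn0 walk01 subrr. Qed.

Lemma transition00 : transition 0 0 = 1.
Proof. by rewrite /transition walk0 central0. Qed.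

Lemma passage00 : passage 0 0 = 1.
Proof.
(* The factor defining [walk R 0 1] is [0 / 0], which is 0. *)
by rewrite /passage walkS walk0 central0 !subr0 !(mulr0, mul0r) subr0.
Qed.

Lemma transitionN0 N : transition N 0 = central N.
Proof. by rewrite /transition addn0 walk0. Qed.

(* [u] evolves by two steps of the simple random walk, observed at even sites,
   from the mass [u0] at the origin and with the source [g] there. *)
Lemma duhamel (u : nat -> nat -> R) (g : nat -> R) (u0 : R) :
  (forall h, u 0%N h = if h == 0%N then u0 else 0) ->
  (forall N h, u N.+1 h.+1 =
     2^-1 * u N h.+1 + 4^-1 * u N h + 4^-1 * u N h.+2) ->
  (forall N, u N.+1 0%N = 2^-1 * u N 0%N + 2^-1 * u N 1%N + g N) ->
  forall N h, u N h = u0 * transition N h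
    + \sum_(j < N) g j * transition (N.-1 - j) h.
Proof.
move=> Hb Hf Hn; elim=> [|N IH] h.
  rewrite Hb big_ord0 addr0; case: h => [|h]; first by rewrite mulr1.
  by rewrite transition0S mulr0.
have E h' : \sum_(j < N.+1) g j * transition (N - j) h' =
    \sum_(j < N) g j * transition (N.-1 - j).+1 h' + g N * transition 0 h'.
  rewrite big_ord_recr /= subnn; congr (_ + _); apply: eq_bigr => i _.
  congr (_ * transition _ _); have := ltn_ord i; lia.
rewrite E; case: h => [|h].
  rewrite Hn !IH transition_near.
  under [X in _ = _ + (X + _)]eq_bigr do
    rewrite transition_near mulrDr !(mulrCA _ 2^-1).
  rewrite big_split /= -!mulr_sumr transition00; lra.
rewrite Hf !IH transition_far transition0S.
under [X in _ = _ + (X + _)]eq_bigr do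
  rewrite transition_far !mulrDr !(mulrCA _ 2^-1) !(mulrCA _ 4^-1).
rewrite !big_split /= -!mulr_sumr; lra.
Qed.

Lemma sum_central N : \sum_(j < N) central j = 2 * N%:R * central N.
Proof.
elim: N => [|N IH]; first by rewrite big_ord0 mulr0 mul0r.
rewrite big_ord_recr /= IH centralS -!natr1 -mul2n natrM.
have : (N%:R + 1 : R) != 0 by rewrite natr1 pnatr_eq0.
move: (N%:R) (central N) => x y x0.
by field; apply/negP => /eqP; move/eqP: x0; lra.
Qed.

(** Exchanging [j] and [N - j] shows that the average index is [N / 2]. *)
Lemma central_convolution_weighted N :
  \sum_(j < N.+1) j%:R * (central j * central (N - j)) =
  N%:R / 2 * \sum_(j < N.+1) central j * central (N - j).
Proof.
set S := LHS; have : S + S =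
    N%:R * \sum_(j < N.+1) central j * central (N - j); last by lra.
rewrite /S {1}(reindex_inj rev_ord_inj) /= -big_split mulr_sumr /=.
apply: eq_bigr => j _; have jN : (j <= N)%N by rewrite -ltnS.
rewrite subSS subKn // natrB //.
by rewrite [central (N - j) * _]mulrC -mulrDl subrK.
Qed.

(* As [N * central N = (N - 1/2) * central N.-1], weighting the convolution by
   the index relates its consecutive values. *)
Lemma central_convolution N : \sum_(j < N.+1) central j * central (N - j) = 1.
Proof.
elim: N => [|N IH]; first by rewrite big_ord1 central0 mulr1.
have := central_convolution_weighted N.+1; rewrite big_ord_recl mul0r add0r.
under eq_bigr => j _.
  have -> : (bump 0 j)%:R * (central (bump 0 j) * central (N.+1 - bump 0 j)) =
      j%:R * (central j * central (N - j))
      + 2^-1 * (central j * central (N - j)) :> R.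
    rewrite /bump /= add1n subSS centralS -!natr1 -mul2n natrM.
    have : (j%:R + 1 : R) != 0 by rewrite natr1 pnatr_eq0.
    by move: (j%:R) => x x0; field; apply/negP => /eqP; move/eqP: x0; lra.
  over.
rewrite big_split /= -mulr_sumr central_convolution_weighted IH !mulr1 => E.
have N0 : (N.+1%:R : R) != 0 by rewrite pnatr_eq0.
apply: (mulfI (mulf_neq0 N0 (invr_neq0 (_ : 2%:R != 0)))).
  by rewrite pnatr_eq0.
by rewrite -E mulr1 -natr1; lra.
Qed.

End Kernel.

(** * The exact law of the degree of symmetry *)

Section ExactLaw.
Variables (R : realType) (b : bool).
(* The two paths have total length [2 * N + b] up to their last steps; only for
   [b = false] can they end together. *)
Notation eps := ((~~ b)%:R : R).
Notation transition := (@transition R).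
Notation passage := (@passage R).
Notation central := (@central R).

(** For [h = 0] this is the expectation of [phi] at the degree of symmetry of a uniform word; the
    same normalisation for all [h] gives the first-step relations the form required by [duhamel]. *)
Definition mean_ds N h (phi : nat -> R) : R :=
  pair_sum (N.*2 + b) h phi / 2 ^+ (N.*2 + b).

Lemma mean_ds0 h (phi : nat -> R) : phi 0%N = 0 ->
  mean_ds 0 h phi = if h == 0%N then eps * phi 1%N else 0.
Proof.
move=> phi0; rewrite /mean_ds; case: b => /=.
  by rewrite pair_sum1 // !mul0r if_same.
by rewrite pair_sum0 expr0 divr1 mul1r.
Qed.

Lemma mean_ds_far N h (phi : nat -> R) : phi 0%N = 0 -> mean_ds N.+1 h.+1 phi =
  2^-1 * mean_ds N h.+1 phi + 4^-1 * mean_ds N h phi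
  + 4^-1 * mean_ds N h.+2 phi.
Proof.
move=> phi0; rewrite /mean_ds doubleS !addSn pair_sum_far // !exprS.
by field; rewrite expf_neq0.
Qed.

Lemma mean_ds_near N (phi : nat -> R) : phi 0%N = 0 -> mean_ds N.+1 0 phi =
  2^-1 * mean_ds N 0 (phi \o succn) + 2^-1 * mean_ds N 1 phi.
Proof.
move=> phi0; rewrite /mean_ds doubleS !addSn pair_sum_near // !exprS.
by field; rewrite expf_neq0.
Qed.

Lemma mean_dsD N h (phi psi : nat -> R) :
  mean_ds N h (fun k => phi k + psi k) = mean_ds N h phi + mean_ds N h psi.
Proof. by rewrite /mean_ds pair_sumD mulrDl. Qed.

Lemma mean_dsZ N h (c : R) (phi : nat -> R) :
  mean_ds N h (fun k => c * phi k) = c * mean_ds N h phi.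
Proof. by rewrite /mean_ds pair_sumZ mulrA. Qed.

Lemma mean_ds_total N : mean_ds N 0 (fun=> 1) = 1.
Proof. by rewrite /mean_ds pair_sum_total divff // expf_neq0. Qed.

Lemma mean_ds_sum N h K (phi : nat -> nat -> R) :
  mean_ds N h (fun j => \sum_(k < K) phi k j) =
  \sum_(k < K) mean_ds N h (phi k).
Proof.
elim: K => [|K IH].
  rewrite big_ord0 -[RHS](mul0r (mean_ds N h (fun=> 0))) -mean_dsZ.
  by congr mean_ds; apply/funext => j; rewrite big_ord0 mul0r.
rewrite big_ord_recr /= -IH -mean_dsD; congr mean_ds.
by apply/funext => j; rewrite big_ord_recr.
Qed.

(** A shared step uses one step of each path, so at most [N] are shared, and the closing one adds at
    most 1. *)
Lemma mean_ds_vanish N h (phi : nat -> R) :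
  (forall j, (j <= N.+1)%N -> phi j = 0) -> mean_ds N h phi = 0.
Proof.
elim: N h phi => [|N IH] h phi phi0.
  by rewrite mean_ds0 ?phi0 // mulr0 if_same.
have phi0' j : (j <= N.+1)%N -> phi j = 0 by move=> jN; rewrite phi0 // ltnW.
case: h => [|h].
  rewrite mean_ds_near ?phi0 // !IH ?mulr0 ?addr0 //.
  by move=> j jN; rewrite /= phi0.
by rewrite mean_ds_far ?phi0 // !IH // !mulr0 !addr0.
Qed.

(** At distance 0 the next step is shared with probability 1/2, which is a constant source [2^-1] in
    [duhamel]; [eps] is the initial mass, due to paths that end together. *)
Lemma mean_ds_id N : mean_ds N 0 (fun k => k%:R) = (N%:R + eps) * central N.
Proof.
rewrite (@duhamel _ (fun N h => mean_ds N h (fun k => k%:R)) (fun=> 2^-1) eps).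
- rewrite -mulr_sumr transitionN0.
  under eq_bigr do rewrite transitionN0.
  case: N => [|N]; first by rewrite big_ord0 mulr0 addr0 add0r.
  rewrite [N.+1.-1]/=.
  have -> : \sum_(j < N.+1) central (N - j) = \sum_(j < N.+1) central j.
    rewrite (reindex_inj rev_ord_inj) /=; apply: eq_bigr => j _.
    by rewrite subSS subKn // -ltnS.
  by rewrite sum_central; field.
- by move=> h; rewrite mean_ds0 // mulr1.
- by move=> M h; rewrite mean_ds_far.
- move=> M; rewrite mean_ds_near //.
  have -> : (fun k => k%:R : R) \o succn = (fun k => k%:R + 1).
    by apply/funext => k /=; rewrite natr1.
  by rewrite mean_dsD mean_ds_total; ring.
Qed.

(** As [(k + 1) * k = k * (k - 1) + 2 * k], the source in [duhamel] is now the mean itself, and the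
    sum becomes a convolution of [central] with itself. *)
Lemma mean_ds_falling2 N : (0 < N)%N ->
  mean_ds N 0 (fun k => k%:R * (k%:R - 1)) = (N%:R - 1) / 2 + eps.
Proof.
case: N => // N _.
rewrite (@duhamel _ (fun N h => mean_ds N h (fun k => k%:R * (k%:R - 1)))
  (fun N => mean_ds N 0 (fun k => k%:R)) 0).
- rewrite mul0r add0r [N.+1.-1]/=.
  under eq_bigr do rewrite mean_ds_id transitionN0 -mulrA mulrDl.
  rewrite big_split /= -mulr_sumr central_convolution mulr1; congr (_ + _).
  rewrite central_convolution_weighted central_convolution -natr1; by field.
- by move=> h; rewrite mean_ds0 ?mul0r // subrr !mulr0.
- by move=> M h; rewrite mean_ds_far // mul0r.
- move=> M; rewrite mean_ds_near ?mul0r //.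
  have -> : (fun k => k%:R * (k%:R - 1) : R) \o succn =
      (fun k => k%:R * (k%:R - 1) + 2 * k%:R).
    by apply/funext => k /=; rewrite -natr1; ring.
  by rewrite mean_dsD mean_dsZ; field.
Qed.

(* The recursion [law] trades one unit of [k], or one unit of [h], for one unit
   of [N], with coefficients independent of [h], whereas first-step analysis
   distinguishes [h = 0]. *)
Definition source k N h : R :=
  match k with
  | 0 => transition N h - eps * passage N h
  | 1 => eps * passage N h
  | _ => 0
  end.

Fixpoint law N h k : R :=
  source k N h + (if N is N'.+1 then
    2^-1 * ((if k is k'.+1 then law N' h k' else 0) + law N' h.+1 k) else 0).

Lemma law0 h k : law 0 h k = source k 0 h.
Proof. by rewrite /= addr0. Qed.

Lemma lawS0 N h :
  law N.+1 h 0 = source 0 N.+1 h + 2^-1 * law N h.+1 0.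
Proof. by rewrite /= add0r. Qed.

Lemma lawSS N h k :
  law N.+1 h k.+1 = source k.+1 N.+1 h + 2^-1 * (law N h k + law N h.+1 k.+1).
Proof. by []. Qed.

Lemma source_far k N h : source k N.+1 h.+1 =
  2^-1 * source k N h.+1 + 4^-1 * source k N h + 4^-1 * source k N h.+2.
Proof.
case: k => [|[|k]] /=; last by rewrite !mulr0 !addr0.
  by rewrite transition_far passage_far; ring.
by rewrite passage_far; ring.
Qed.

Lemma source0S k h : source k 0 h.+1 = 0.
Proof.
by case: k => [|[|k]] //=; rewrite ?passage0S ?transition0S !(mulr0, subr0).
Qed.

Lemma sourceS0 k N : source k.+1 N.+1 0 = 0.
Proof. by case: k => //=; rewrite passageS0 mulr0. Qed.

(** The coefficients in the recursion of [law] do not depend on [h], so the relation satisfied by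
    [source] is inherited by induction on [N]. *)
Lemma law_far N h k : law N.+1 h.+1 k =
  2^-1 * law N h.+1 k + 4^-1 * law N h k + 4^-1 * law N h.+2 k.
Proof.
elim: N h k => [|N IH] h k.
  case: k => [|k]; rewrite ?lawS0 ?lawSS !law0 source_far !source0S; ring.
case: k => [|k].
  by rewrite !(lawS0 N) (lawS0 N.+1) IH source_far; ring.
by rewrite !(lawSS N) (lawSS N.+1) !IH source_far; ring.
Qed.

(** For [h = 0] and positive [N] and [k] the source vanishes, and the recursion of [law] is itself
    the first-step relation at the origin. *)
Lemma law_near N k : law N.+1 0 k.+1 = 2^-1 * law N 0 k + 2^-1 * law N 1 k.+1.
Proof. by rewrite lawSS sourceS0 add0r mulrDr. Qed.

Lemma sum_source N h K : \sum_(k < K.+2) source k N h = transition N h.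
Proof.
rewrite !big_ord_recl big1 /=; last by [].
by rewrite addr0 subrK.
Qed.

(** The total at [h = 0] for [N.+1] involves that at [h = 1] for [N], which the statement on
    differences supplies to the induction. *)
Lemma sum_law N K : (N.+1 < K)%N -> \sum_(k < K) law N 0 k = 1 /\
  forall h, \sum_(k < K) law N h k - \sum_(k < K) law N h.+1 k =
    transition N h + transition N h.+1.
Proof.
have rec M L h : \sum_(k < L.+3) law M.+1 h k = transition M.+1 h +
    2^-1 * (\sum_(k < L.+2) law M h k + \sum_(k < L.+3) law M h.+1 k).
  rewrite -(sum_source M.+1 h L.+1) big_ord_recl [in RHS]big_ord_recl lawS0.
  rewrite [X in _ = _ + _ * (_ + X)]big_ord_recl.
  have -> : \sum_(i < L.+2) law M.+1 h (lift ord0 i) =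
      \sum_(i < L.+2) source (lift ord0 i) M.+1 h +
      2^-1 * (\sum_(i < L.+2) law M h i +
              \sum_(i < L.+2) law M h.+1 (lift ord0 i)).
    by rewrite -big_split mulr_sumr -big_split.
  by ring.
elim: N K => [|N IH] K.
  case: K => [|[|K]] // _; split.
    under eq_bigr do rewrite law0.
    by rewrite sum_source transition00.
  move=> h; under eq_bigr do rewrite law0.
  under [X in _ - X]eq_bigr do rewrite law0.
  by rewrite !sum_source transition0S subr0 addr0.
case: K => [|[|[|K]]] // NK.
have [|one diff] := IH K.+3; first exact: ltnW.
have [//|one' diff'] := IH K.+2.
split.
  rewrite rec one' transition_near.
  have := diff 0%N; rewrite one; lra.
move=> h; rewrite !rec transition_far.
have := diff h.+1; have := diff' h; lra.
Qed.

Definition indicator k (j : nat) : R := (j == k)%:R.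

Lemma sum_indicator K j : \sum_(k < K) indicator k j = (j < K)%:R.
Proof.
rewrite /indicator; have [jK|Kj] := ltnP j K.
  rewrite (bigD1 (Ordinal jK)) //= eqxx big1 ?addr0 // => i.
  by rewrite -val_eqE /= eq_sym => /negbTE ->.
by rewrite big1 // => i _; rewrite gtn_eqF // (leq_trans (ltn_ord i)).
Qed.

Lemma sum_mean_ds_indicator N :
  \sum_(k < N.+2) mean_ds N 0 (indicator k) = 1.
Proof.
rewrite -mean_ds_sum -[RHS](mean_ds_total N) -[RHS]subr0.
have V : mean_ds N 0 (fun j => (N.+1 < j)%:R) = 0.
  by apply: mean_ds_vanish => j jN; rewrite ltnNge jN.
rewrite -[X in _ = _ - X]V -[- _]mulN1r -mean_dsZ -mean_dsD; congr mean_ds.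
apply/funext => j; rewrite mulN1r sum_indicator ltnS leqNgt.
by case: (N.+1 < j)%N; rewrite /= ?subrr ?subr0.
Qed.

(** For positive [k] both sides obey the same first-step relations. As [indicator 0] does not vanish
    at 0, the value at [k = 0] is instead deduced from the total mass 1 of both laws. *)
Lemma mean_ds_law N : mean_ds N 0 (indicator 0) = law N 0 0 /\
  forall h k, mean_ds N h (indicator k.+1) = law N h k.+1.
Proof.
have closing M : (forall h k, mean_ds M h (indicator k.+1) = law M h k.+1) ->
    mean_ds M 0 (indicator 0) = law M 0 0 /\
    forall h k, mean_ds M h (indicator k.+1) = law M h k.+1.
  move=> H; split; last by [].
  have [//|one _] := @sum_law M M.+2.
  have := sum_mean_ds_indicator M.
  rewrite -one big_ord_recl [in RHS]big_ord_recl.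
  by under eq_bigr do rewrite H; move=> /addIr.
elim: N => [|N [IH0 IH]]; apply: closing => h k.
  rewrite mean_ds0 // law0; case: h => [|h]; last by rewrite source0S.
  by case: k => [|k] /=; rewrite /indicator ?passage00 ?mulr0.
case: h => [|h]; last by rewrite mean_ds_far // law_far !IH.
rewrite mean_ds_near // law_near IH.
have -> : indicator k.+1 \o succn = indicator k.
  by apply/funext => j; rewrite /indicator /= eqSS.
by case: k => [|k]; rewrite ?IH0 ?IH.
Qed.

Lemma mean_ds_indicator N k : mean_ds N 0 (indicator k) = law N 0 k.
Proof. by have [H0 H] := mean_ds_law N; case: k. Qed.

End ExactLaw.

(** * Wallis' bounds *)

Section Wallis.
Variable R : realType.
Notation central := (@central R).

(* The antiderivative of [sin ^+ n] vanishing at [0], given together with that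
   of [sin ^+ n.+1]. *)
Fixpoint sin_prims n : (R -> R) * (R -> R) :=
  if n is m.+1 then
    let: (F, G) := sin_prims m in
    (G, fun x => (m.+2)%:R^-1 * (m.+1%:R * F x - cos x * sin x ^+ m.+1))
  else (fun x => x, fun x => 1 - cos x).

Definition sin_prim n := (sin_prims n).1.

Lemma sin_primSS n x : sin_prim n.+2 x =
  (n.+2)%:R^-1 * (n.+1%:R * sin_prim n x - cos x * sin x ^+ n.+1).
Proof. by rewrite /sin_prim /=; case: (sin_prims n). Qed.

Lemma nat_ind2 (P : nat -> Prop) : P 0%N -> P 1%N ->
  (forall n, P n -> P n.+2) -> forall n, P n.
Proof.
move=> P0 P1 PS n; suff [] : P n /\ P n.+1 by [].
by elim: n => [|n [Pn PSn]]; split => //; exact: PS.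
Qed.

Lemma is_derive_sin_prim n (x : R) : is_derive x 1 (sin_prim n) (sin x ^+ n).
Proof.
elim/nat_ind2: n => [||n IH].
- by rewrite expr0; exact: is_derive_id.
- rewrite expr1 /sin_prim /=; apply: is_derive_eq.
  by rewrite add0r mul1r opprK.
have D := is_deriveZ (n.+2%:R^-1) (is_deriveB (is_deriveZ (n.+1)%:R IH)
  (is_deriveM (is_derive_cos x) (is_deriveX n.+1 (is_derive_sin x)))).
have E : n.+2%:R^-1 \*: (n.+1%:R \*: sin_prim n - cos * sin ^+ n.+1)
    = sin_prim n.+2.
  by apply/funext => y; rewrite sin_primSS /= !fctE.
rewrite E in D; apply: (is_derive_eq D).
rewrite !fctE.
have c2 : cos x ^+ 2 = 1 - sin x ^+ 2 by rewrite cos2sin2.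
rewrite [LHS](_ : _ = n.+2%:R^-1 * (n.+1%:R * sin x ^+ n * (1 - cos x ^+ 2)
  + sin x ^+ n.+1 * sin x)); last by rewrite /GRing.scale /=; ring.
have -> : 1 - cos x ^+ 2 = sin x ^+ 2 by rewrite c2; ring.
rewrite !exprS -[n.+2%:R]natr1.
have : (n.+1%:R + 1 : R) != 0 by rewrite natr1 pnatr_eq0.
by move: (n.+1%:R) => y y0; rewrite expr0; field.
Qed.

(** Mean value theorem: the difference of the two primitives vanishes at 0 and has derivative
    [sin ^+ n * (1 - sin)], which is nonnegative up to [pi / 2]. *)
Lemma sin_prim_le n : sin_prim n.+1 (pi / 2) <= sin_prim n (pi / 2).
Proof.
have p0 : 0 < pi / 2 :> R by rewrite divr_gt0 ?pi_gt0.
have z m : sin_prim m 0 = 0.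
  elim/nat_ind2: m => [//||m IH]; first by rewrite /sin_prim /= cos0 subrr.
  by rewrite sin_primSS IH sin0 expr0n /= !mulr0 subrr mulr0.
have D x := is_deriveB (is_derive_sin_prim n x) (is_derive_sin_prim n.+1 x).
have cD : {within `[0, pi / 2], continuous (sin_prim n - sin_prim n.+1)}.
  apply: continuous_subspaceT => x.
  by apply: differentiable_continuous; apply/derivable1_diffP; case: (D x).
have [c] := MVT p0 (fun x _ => D x) cD.
have fE y : (sin_prim n - sin_prim n.+1) y = sin_prim n y - sin_prim n.+1 y.
  by [].
rewrite !fE {fE D cD}.
rewrite in_itv /= => /andP[c0 cp]; rewrite !z !subr0 -subr_ge0 => ->.
apply: mulr_ge0; last exact: ltW.
rewrite exprS -{1}[sin c ^+ n]mul1r -mulrBl; apply: mulr_ge0.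
  by rewrite subr_ge0 sin_le1.
by rewrite exprn_ge0 // ltW // sin_gt0_pihalf // c0.
Qed.

Lemma sin_prim_even N : sin_prim N.*2 (pi / 2) = central N * (pi / 2).
Proof.
elim: N => [|N IH]; first by rewrite central0 mul1r.
rewrite doubleS sin_primSS IH cos_pihalf mul0r subr0 centralS.
by move: (N.*2.+2)%:R^-1 (N.*2.+1)%:R => x y; ring.
Qed.

Lemma central_gt0 N : 0 < central N.
Proof.
elim: N => [|N IH]; first by rewrite central0.
by rewrite centralS mulr_gt0 // divr_gt0 ?ltr0n.
Qed.

Lemma sin_prim_odd N : (N.*2.+1)%:R * central N * sin_prim N.*2.+1 (pi / 2) = 1.
Proof.
elim: N => [|N IH].
  by rewrite central0 /sin_prim /= cos_pihalf subr0 !mulr1.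
rewrite doubleS sin_primSS cos_pihalf mul0r subr0 centralS -[RHS]IH.
have N0 i : (N.*2.+1 + i)%:R != 0 :> R by rewrite addSn pnatr_eq0.
have := N0 2; have := N0 1; have := N0 0; rewrite addn0 addn1 addn2.
move: (N.*2.+3)%:R (N.*2.+2)%:R (N.*2.+1)%:R => x y z x0 y0 z0.
by field; apply/andP.
Qed.

(** Both bounds compare consecutive integrals of powers of [sin]: exponents [2 * N] and [2 * N - 1]
    here, [2 * N + 1] and [2 * N] in [wallis_ge]. *)
Lemma wallis_le N : pi * N%:R * central N ^+ 2 <= 1.
Proof.
case: N => [|N]; first by rewrite mulr0 mul0r.
have := sin_prim_le N.*2.+1; rewrite -doubleS sin_prim_even => h.
have := sin_prim_odd N; have c0 := central_gt0 N.
have -> : (N.*2.+1)%:R * central N = 2 * N.+1%:R * central N.+1.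
  rewrite centralS -[N.*2.+2]/(N.+1).*2 -[(N.+1).*2]mul2n natrM.
  have N0 : (N.+1%:R : R) != 0 by rewrite pnatr_eq0.
  by move: (N.+1)%:R N0 => x x0; field.
move=> E; rewrite -[X in _ <= X]E -subr_ge0.
have -> : 2 * N.+1%:R * central N.+1 * sin_prim N.*2.+1 (pi / 2)
    - pi * N.+1%:R * central N.+1 ^+ 2 =
    2 * N.+1%:R * central N.+1 *
    (sin_prim N.*2.+1 (pi / 2) - central N.+1 * (pi / 2)).
  by field.
by rewrite mulr_ge0 ?subr_ge0 // !mulr_ge0 // ltW // central_gt0.
Qed.

Lemma wallis_ge N : 1 <= pi * (N%:R + 2^-1) * central N ^+ 2.
Proof.
have := sin_prim_le N.*2; rewrite sin_prim_even => h.
have := sin_prim_odd N; have c0 := central_gt0 N.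
move=> E; rewrite -[X in X <= _]E -subr_ge0.
have -> : pi * (N%:R + 2^-1) * central N ^+ 2
    - (N.*2.+1)%:R * central N * sin_prim N.*2.+1 (pi / 2) =
  (N.*2.+1)%:R * central N * (central N * (pi / 2) - sin_prim N.*2.+1 (pi / 2)).
  by rewrite -!natr1 -mul2n natrM; field.
by rewrite mulr_ge0 ?subr_ge0 // mulr_ge0 // ltW.
Qed.

End Wallis.

(** * The local law *)

Section WalkBounds.
Variable R : realType.
Notation central := (@central R).
Notation walk := (@walk R).

Lemma walk_ge0 M m : 0 <= walk M m.
Proof.
elim: m => [|m IH]; first by rewrite walk0 ltW // central_gt0.
have [mM|Mm] := leqP m M; last by rewrite walk_gt // ltnS ltnW.
have mM' : m%:R <= M%:R :> R by rewrite ler_nat.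
rewrite walkS mulr_ge0 // divr_ge0 //; first lra.
by have := ler0n R m; lra.
Qed.

Lemma walk_diff M m : (0 < M)%N -> (m <= M)%N ->
  walk M m - walk M m.+1 = walk M m * (m%:R / (2 * M%:R - m%:R)).
Proof.
move=> M0 mM; rewrite walkS.
have mM' : m%:R <= M%:R :> R by rewrite ler_nat.
have M0' : 0 < M%:R :> R by rewrite ltr0n.
by field; apply: lt0r_neq0; lra.
Qed.

Lemma walk_dec M m : walk M m.+1 <= walk M m.
Proof.
have [Mm|mM] := ltnP M m; first by rewrite !walk_gt // ltnW.
have [M0|M0] := posnP M.
  by move: mM; rewrite M0 leqn0 => /eqP ->; rewrite [leLHS]walk_gt // walk_ge0.
have mM' : m%:R <= M%:R :> R by rewrite ler_nat.
rewrite -subr_ge0 walk_diff // mulr_ge0 ?walk_ge0 // divr_ge0 //.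
by have := ler0n R M; lra.
Qed.

Lemma walk_le M m : walk M m <= central M.
Proof.
elim: m => [|m IH]; first by rewrite walk0.
exact: le_trans (walk_dec M m) IH.
Qed.

(** A polynomial substitute for Gaussian decay, which absorbs the factors [m ^+ 2] arising in
    differences. The left side is nonincreasing in [m]. *)
Lemma walk_quadratic M m : (m <= M)%N ->
  walk M m * (4 * M%:R + m%:R * (m%:R - 1)) <= 4 * M%:R * central M.
Proof.
elim: m => [|m IH] mM; first by rewrite mul0r addr0 walk0 mulrC.
apply: le_trans (IH (ltnW mM)).
have mM' : m%:R + 1 <= M%:R :> R by rewrite natr1 ler_nat.
have m0 := ler0n R m.
rewrite walkS -mulrA ler_wpM2l ?walk_ge0 // mulrAC -[m.+1%:R]natr1 addrK.
rewrite ler_pdivrMr; last lra.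
rewrite -subr_ge0; move: (m%:R) (M%:R) mM' m0 => x y xy x0.
rewrite (_ : _ - _ = x ^+ 3 + 3 * x ^+ 2); last by ring.
by rewrite addr_ge0 ?mulr_ge0 ?exprn_ge0.
Qed.

Lemma central_sqr_le M : M%:R * central M ^+ 2 <= 1.
Proof.
apply: le_trans (wallis_le R M).
rewrite -mulrA ler_peMl ?mulr_ge0 ?(ltW (central_gt0 _ _)) //.
by have := pi_ge2 R; lra.
Qed.

Lemma central_le M : (0 < M)%N -> central M <= (Num.sqrt M%:R)^-1.
Proof.
move=> M0; have M0' : 0 < M%:R :> R by rewrite ltr0n.
rewrite -div1r ler_pdivlMr ?sqrtr_gt0 //.
rewrite -(@ler_pXn2r _ 2) ?nnegrE //; last first.
  by rewrite mulr_ge0 ?sqrtr_ge0 // ltW // central_gt0.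
by rewrite exprMn sqr_sqrtr ?ler0n // expr1n mulrC central_sqr_le.
Qed.

Lemma central_dec M N : (M <= N)%N -> central N <= central M.
Proof.
elim: N => [|N IH]; first by rewrite leqn0 => /eqP ->.
rewrite leq_eqVlt => /predU1P[-> //|/IH]; apply: le_trans.
have r1 : (N.*2.+1)%:R / (N.*2.+2)%:R <= 1 :> R.
  by rewrite ler_pdivrMr ?ltr0n // mul1r ler_nat.
by rewrite centralS ler_piMr // ltW // central_gt0.
Qed.

Lemma walk_diff_le M m : (0 < M)%N -> walk M m - walk M m.+1 <= 3 / M%:R.
Proof.
move=> M0; have M0' : 0 < M%:R :> R by rewrite ltr0n.
have [Mm|mM] := ltnP M m.
  by rewrite !walk_gt ?subrr ?divr_ge0 // ltnW.
have mM' : m%:R <= M%:R :> R by rewrite ler_nat.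
have w0 := walk_ge0 M m; have wc := walk_le M m.
(* The square is at most [(8 * M + 1) * central M ^+ 2], hence at most 9, as
   [M * central M ^+ 2 <= 1]. *)
have wm : walk M m * m%:R <= 3.
  rewrite -(@ler_pXn2r _ 2) ?nnegrE ?mulr_ge0 // exprMn.
  have := walk_quadratic mM; have := central_sqr_le M.
  have M1 : 1 <= M%:R :> R by rewrite ler1n.
  move: (walk M m) (central M) w0 wc (m%:R) (M%:R) M1 => w c w0 wc x y y1 cy q.
  have c0 : 0 <= c := le_trans w0 wc.
  have : w * x ^+ 2 <= (8 * y + 1) * c.
    have : 0 <= w * (x - 1) ^+ 2 by rewrite mulr_ge0 ?sqr_ge0.
    have : 0 <= w * y by rewrite mulr_ge0 // ltW // (lt_le_trans ltr01).
    lra.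
  move=> /(ler_wpM2l w0) h.
  have : w * ((8 * y + 1) * c) <= c * ((8 * y + 1) * c).
    by rewrite ler_wpM2r // mulr_ge0 //; lra.
  have : c ^+ 2 <= y * c ^+ 2 by rewrite ler_peMl ?sqr_ge0.
  rewrite !expr2 in h cy *; lra.
rewrite walk_diff // mulrA.
apply: (@le_trans _ _ (walk M m * m%:R / M%:R)).
  rewrite ler_wpM2l ?mulr_ge0 // lef_pV2 ?posrE; lra.
by rewrite ler_pM2r ?invr_gt0.
Qed.

Lemma walk_diff2_le M m : (0 < M)%N ->
  `|walk M m - 2 * walk M m.+1 + walk M m.+2| <= 4 * central M / M%:R.
Proof.
move=> M0; have M0' : 0 < M%:R :> R by rewrite ltr0n.
have c0 := central_gt0 R M.
have [Mm|mM] := ltnP M m.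
  rewrite !walk_gt //; try by rewrite ?ltnS ltnW // ltnW.
  by rewrite mulr0 subr0 addr0 normr0 divr_ge0 ?mulr_ge0 // ltW.
have mM' : m%:R <= M%:R :> R by rewrite ler_nat.
have w0 := walk_ge0 M m; have := walk_quadratic mM.
have m0 := ler0n R m.
(* For [m = M] only the first term survives; the closed form used afterwards would have denominator
   0 at [M = 1]. *)
move: mM; rewrite leq_eqVlt => /predU1P[->|mM].
  rewrite [walk M M.+1]walk_gt // [walk M M.+2]walk_gt // mulr0 subr0 addr0.
  rewrite ger0_norm ?walk_ge0 // ler_pdivlMr //.
  have := walk_ge0 M M.
  move: (walk M M) (M%:R) (central M) M0' => w x c x0 w0' h.
  have : 0 <= w * 3 * x by rewrite !mulr_ge0 // ltW.
  by move=> h2; rewrite -(ler_pM2r x0); lra.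
have {mM'}mM' : m%:R + 1 <= M%:R :> R by rewrite natr1 ler_nat.
have -> : walk M m - 2 * walk M m.+1 + walk M m.+2 = walk M m *
    (m%:R ^+ 2 + m%:R - 2 * M%:R) /
    ((2 * M%:R - m%:R) * (2 * M%:R - m%:R - 1)).
  rewrite (walkS _ M m.+1) (walkS _ M m) -[m.+1%:R]natr1.
  by field; apply/andP; split; apply: lt0r_neq0; lra.
move: (walk M m) w0 (central M) c0 (m%:R) m0 (M%:R) M0' mM'.
move=> w w0 c c0 x x0 y y0 xy q.
rewrite normrM normrM (ger0_norm w0) normfV [X in _ / X]gtr0_norm; last first.
  by rewrite mulr_gt0; lra.
rewrite ler_pdivrMr; last by rewrite mulr_gt0; lra.
(* The numerator is controlled by [walk_quadratic], and the denominator is at least [y * y] because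
   [x + 1 <= y]. *)
apply: (@le_trans _ _ (4 * y * c)).
  apply: le_trans q; rewrite ler_wpM2l // ler_norml; apply/andP; split.
    have := sqr_ge0 x; lra.
  lra.
have -> : 4 * y * c = 4 * c / y * (y * y) by field; apply: lt0r_neq0.
apply: ler_wpM2l; first by rewrite divr_ge0 ?mulr_ge0 // ltW.
by apply: ler_pM; lra.
Qed.

End WalkBounds.

(** * Comparison of the exact law with the walk probabilities *)

Section LawEstimate.
Variables (R : realType) (b : bool) (M0 : nat) (gamma delta : R).
Notation walk := (@walk R).
Notation law := (@law R b).
Hypothesis M0_gt0 : (0 < M0)%N.
Hypothesis walk1 : forall M m, (M0 <= M)%N -> walk M m - walk M m.+1 <= gamma.
Hypothesis walk2 : forall M m, (M0 <= M)%N ->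
  `|walk M m - 2 * walk M m.+1 + walk M m.+2| <= delta.

(* If [walk] were affine in its second argument, [law N h k] would satisfy its
   recursion with [2 * walk (N + h) (h + k).*2] in its place: each unit of [k]
   costs second differences only. *)
Lemma law_walk N h k : (M0 + k <= N + h)%N ->
  `|law N h k - 2 * walk (N + h) (h + k).*2| <=
    6 * gamma + 2 * gamma *+ (0 < k)%N + 6 * delta *+ k.
Proof.
have g0 : 0 <= gamma.
  apply: le_trans (walk1 0 (leqnn M0)); by rewrite subr_ge0 walk_dec.
have d0 : 0 <= delta by apply: le_trans (walk2 0 (leqnn M0)).
have passage_le K i : (M0 <= K + i)%N ->
    0 <= (~~ b)%:R * passage R K i <= gamma.
  move=> /(walk1 i.*2) w1.
  have p0 : 0 <= passage R K i by rewrite subr_ge0 walk_dec.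
  case: (b) => /=; rewrite ?mul0r ?lexx ?mul1r //.
  by apply/andP.
elim: N h k => [|N IH] h k.
  (* Here [M0 + k <= h] forces [0 < h], so both the source and the walk probability vanish. *)
  rewrite add0n => h0; rewrite law0 walk_gt; last first.
    by rewrite -addnn; lia.
  have -> : source R b k 0 h = 0.
    by case: h h0 => [|h] h0; [lia|rewrite source0S].
  by rewrite mulr0 subrr normr0 !addr_ge0 ?mulr_ge0 ?mulrn_wge0 ?mulr_ge0.
move=> MN; have MN' : (M0 <= N.+1 + h)%N by lia.
have IH1 : `|law N h.+1 k - 2 * walk (N.+1 + h) (h + k).+1.*2| <=
    6 * gamma + 2 * gamma *+ (0 < k)%N + 6 * delta *+ k.
  by have := IH h.+1 k; rewrite addnS -addSn addSn; apply.
move: IH1; rewrite doubleS; case: k MN => [|k] MN.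
  rewrite addn0 lawS0 /= /transition !mulr0n !addr0 => IH1.
  have := passage_le _ _ MN'; have := walk1 h.*2 MN'; have := walk1 h.*2.+1 MN'.
  have := walk_dec R (N.+1 + h) h.*2; have := walk_dec R (N.+1 + h) h.*2.+1.
  move: IH1; rewrite !ler_norml.
  move: (_ * passage _ _ _) (law N h.+1 0) => e l.
  move: (walk _ h.*2.+2) (walk _ h.*2.+1) (walk _ h.*2) => w2 w1 w0.
  (* The inherited error is halved to [3 * gamma]; two first differences and one passage term add at
     most [3 * gamma]. *)
  move=> /andP[? ?] ? ? ? ? /andP[? ?]. apply/andP; split; lra.
have : `|law N h k - 2 * walk (N + h) (h + k).*2| <=
    6 * gamma + 2 * gamma *+ (0 < k)%N + 6 * delta *+ k by apply: IH; lia.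
rewrite lawSS addnS doubleS (walk_pascal _ (N + h)) -!addSn.
set m := (h + k).*2.
(* The averaged main terms miss the target by [2 * w1 - 3 * w2 + w4], twice one second difference
   plus the next one: at most [3 * delta], which averaging the inherited bounds leaves available.
   For [k = 1] the source costs a further [gamma]. *)
have := walk2 m.+1 MN'; have := walk2 m.+2 MN'.
case: k @m MN => [|k] m MN.
  have -> : source R b 1 N.+1 h = (~~ b)%:R * passage R N.+1 h by [].
  have := passage_le _ _ MN'; rewrite !mulr0n !mulr1n !addr0 !ler_norml.
  move: (_ * passage _ _ _) (law N h 0) (law N h.+1 1) => e l l'.
  move: (walk _ m.+4) (walk _ m.+3) (walk _ m.+2) (walk _ m.+1).
  move=> w4 w3 w2 w1.
  move=> /andP[? ?] /andP[? ?] /andP[? ?] /andP[? ?] /andP[? ?].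
  by apply/andP; split; lra.
rewrite [source _ _ _ _ _]/= add0r [6 * delta *+ k.+2]mulrS.
move: (6 * delta *+ k.+1) => D; rewrite !ler_norml.
move: (law N h k.+1) (law N h.+1 k.+2) => l l'.
move: (walk _ m.+4) (walk _ m.+3) (walk _ m.+2) (walk _ m.+1).
move=> w4 w3 w2 w1.
move=> /andP[? ?] /andP[? ?] /andP[? ?] /andP[? ?].
by apply/andP; split; lra.
Qed.

End LawEstimate.

(** * Gaussian approximation of the walk probabilities *)

Section Gaussian.
Variable R : realType.
Notation central := (@central R).
Notation walk := (@walk R).
Implicit Types n x v t : R.

Lemma expRN_le t : 0 <= t -> expR (- t) <= 1 - t + t ^+ 2.
Proof.
move=> t0; rewrite expRN -div1r ler_pdivrMr ?expR_gt0 //.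
have h : 0 <= 1 - t + t ^+ 2 by have := sqr_ge0 (t - 1); nra.
apply: le_trans (ler_wpM2l h (expR_ge1Dx t)).
have -> : (1 - t + t ^+ 2) * (1 + t) = 1 + t ^+ 3 by ring.
by rewrite lerDl exprn_ge0.
Qed.

Lemma mul_expRN_le1 t : t * expR (- t) <= 1.
Proof.
rewrite expRN ler_pdivrMr ?expR_gt0 // mul1r.
by apply: le_trans (expR_ge1Dx t); rewrite lerDr.
Qed.

(** When [m = x] increases by 1, [walk] is multiplied by [1 - x / (2 * n - x)] and the Gaussian by
    [expR (- tau)] with [tau = (2 * x + 1) / (4 * v)]. This and the next two lemmas compare these
    factors. *)
Lemma ratio_upper n x v : 1 <= n -> 0 <= x <= n -> n + 1 <= v <= n + 3 / 2 ->
  x / (2 * n - x) - (2 * x + 1) / (4 * v) <= x ^+ 2 / (2 * n ^+ 2) + 3 / 4 / n.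
Proof.
move=> n1 /andP[x0 xn] /andP[nv vn].
have n0 : 0 < n by lra.
have v0 : 0 < v by lra.
have n0' := lt0r_neq0 n0; have v0' := lt0r_neq0 v0.
have h1 : x / (2 * n - x) <= x / (2 * n) + x ^+ 2 / (2 * n ^+ 2).
  rewrite ler_pdivrMr; last lra.
  have -> : (x / (2 * n) + x ^+ 2 / (2 * n ^+ 2)) * (2 * n - x) =
      x + x ^+ 2 * (n - x) / (2 * n ^+ 2) by field.
  rewrite lerDl divr_ge0 ?mulr_ge0 ?sqr_ge0 ?exprn_ge0 //; lra.
have h2 : x / (2 * n) - (2 * x + 1) / (4 * v) <= 3 / 4 / n.
  have -> : x / (2 * n) - (2 * x + 1) / (4 * v) =
      (2 * (x / v) * (v - n) / n - v^-1) / 4.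
    by field; rewrite n0' v0'.
  have p0 : 0 <= x / v by rewrite divr_ge0 // ltW.
  have p1 : x / v <= 1 by rewrite ler_pdivrMr // mul1r; lra.
  have i0 : 0 < v^-1 by rewrite invr_gt0.
  have j0 : 0 < n^-1 by rewrite invr_gt0.
  have q : x / v * (v - n) <= 1 * (3 / 2) by apply: ler_pM => //; lra.
  have := ler_wpM2r (ltW j0) q.
  move: (x / v * (v - n)) (n^-1) (v^-1) i0 j0 => a b c; rewrite -!mulrA => *.
  lra.
lra.
Qed.

Lemma ratio_lower n x v : 1 <= n -> 0 <= x <= n -> n + 1 <= v ->
  (2 * x + 1) / (4 * v) - x / (2 * n - x) <= n^-1.
Proof.
move=> n1 /andP[x0 xn] nv.
have n0 : 0 < n by lra.
have v0 : 0 < v by lra.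
have n0' := lt0r_neq0 n0; have v0' := lt0r_neq0 v0.
have h1 : x / (2 * v) <= x / (2 * n - x).
  by rewrite ler_wpM2l // lef_pV2 ?posrE; lra.
have -> : (2 * x + 1) / (4 * v) = x / (2 * v) + v^-1 / 4 by field.
have i0 : 0 < v^-1 by rewrite invr_gt0.
have : v^-1 <= n^-1 by rewrite lef_pV2 ?posrE; lra.
lra.
Qed.

Lemma ratio_sqr n x v : 1 <= n -> 0 <= x -> n + 1 <= v ->
  ((2 * x + 1) / (4 * v)) ^+ 2 <= x ^+ 2 / (2 * n ^+ 2) + 8^-1 / n.
Proof.
move=> n1 x0 nv.
have n0 : 0 < n by lra.
have v0 : 0 < v by lra.
have n0' := lt0r_neq0 n0; have v0' := lt0r_neq0 v0.
apply: (@le_trans _ _ ((8 * x ^+ 2 + 2) / (16 * n ^+ 2))).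
  rewrite expr_div_n; apply: ler_pM; rewrite ?sqr_ge0 ?invr_ge0 ?sqr_ge0 //.
    by have := sqr_ge0 (2 * x - 1); nra.
  rewrite lef_pV2 ?posrE ?exprn_gt0 ?mulr_gt0 ?exprn_gt0 //.
  rewrite exprMn (_ : 4 ^+ 2 = 16); last by ring.
  by rewrite ler_pM2l // ler_pXn2r ?nnegrE //; lra.
have -> : (8 * x ^+ 2 + 2) / (16 * n ^+ 2) =
    x ^+ 2 / (2 * n ^+ 2) + 8^-1 / n / n.
  by field.
by rewrite lerD2l ler_pdivrMr // ler_peMr // divr_ge0 // ltW.
Qed.

(** Induction on [m]: the ratio [rho] is at most 1, so the inherited error does not grow, and each
    step adds at most [12 / N * central N]. *)
Lemma walk_gauss N m v : (0 < N)%N -> (m <= N)%N ->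
  N%:R + 1 <= v <= N%:R + 3 / 2 ->
  `|walk N m - central N * expR (- (m%:R ^+ 2 / (4 * v)))|
    <= 12 * m%:R / N%:R * central N.
Proof.
move=> N0 + vN; have [nv vn] := andP vN.
have n1 : 1 <= N%:R :> R by rewrite ler1n.
have n0 : 0 < N%:R :> R by lra.
have v0 : 0 < v by lra.
have c0 := central_gt0 R N.
elim: m => [|m IH] mN.
  rewrite expr0n mul0r oppr0 expR0 walk0 mulr1 subrr normr0.
  by rewrite mulr0 !mul0r.
have {}IH := IH (ltnW mN).
have mN' : m%:R <= N%:R :> R by rewrite ler_nat ltnW.
have m0 := ler0n R m.
set x : R := m%:R in IH mN' m0 *.
set n : R := N%:R in nv vn n1 n0 mN' vN IH *.
set rho := 2 * (n - x) / (2 * n - x).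
set tau := (2 * x + 1) / (4 * v).
set e := expR (- (x ^+ 2 / (4 * v))) in IH.
have -> : expR (- (m.+1%:R ^+ 2 / (4 * v))) = e * expR (- tau).
  rewrite /e -expRD /tau -natr1 -/x; congr expR.
  by field; apply: lt0r_neq0.
have -> : walk N m.+1 = walk N m * rho by rewrite walkS.
have rhoE : rho = 1 - x / (2 * n - x).
  by rewrite /rho; field; apply: lt0r_neq0; lra.
have r0 : 0 <= rho by rewrite /rho divr_ge0 ?mulr_ge0 //; lra.
have r1 : rho <= 1.
  by rewrite rhoE gerBl divr_ge0 //; lra.
have t0 : 0 <= tau by rewrite /tau divr_ge0 ?mulr_ge0 //; lra.
have e0 : 0 <= e by rewrite expR_ge0.
have e1 : e <= 1.
  rewrite /e -[leRHS](@expR0 R) ler_expR oppr_le0 divr_ge0 ?sqr_ge0 //; lra.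
(* From [t * expR (- t) <= 1] the left side is at most [4 * v <= 4 * n + 6]. This decay tames the
   error [x ^+ 2 / n ^+ 2] of the ratios. *)
have ex : e * x ^+ 2 <= 10 * n.
  have := mul_expRN_le1 (x ^+ 2 / (4 * v)).
  rewrite -/e mulrAC ler_pdivrMr; last lra.
  by rewrite mul1r mulrC => /le_trans; apply; lra.
have hr : e * `|rho - expR (- tau)| <= 12 / n.
  have i0 : 0 < n^-1 by rewrite invr_gt0.
  have x01 : 0 <= x <= n by apply/andP.
  have up := ratio_upper n1 x01 vN.
  have lo := ratio_lower n1 x01 nv.
  have sq := ratio_sqr n1 m0 nv.
  have E1 := expRN_le t0; have E0 := expR_ge1Dx (- tau).
  rewrite -/tau in up lo sq.
  have q : `|rho - expR (- tau)| <= x ^+ 2 / n ^+ 2 + n^-1.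
    have y0 : 0 <= x ^+ 2 / (2 * n ^+ 2).
      by rewrite divr_ge0 ?mulr_ge0 ?sqr_ge0.
    have yE : x ^+ 2 / n ^+ 2 = 2 * (x ^+ 2 / (2 * n ^+ 2)).
      by field; apply: lt0r_neq0.
    by rewrite ler_norml rhoE; apply/andP; split; lra.
  apply: (le_trans (ler_wpM2l e0 q)); rewrite mulrDr.
  have : e * n^-1 <= 1 * n^-1 by rewrite ler_wpM2r // ltW.
  have : e * (x ^+ 2 / n ^+ 2) <= 10 / n.
    rewrite mulrA ler_pdivrMr ?exprn_gt0 // (le_trans ex) //.
    by rewrite expr2 mulrA divfK ?lt0r_neq0.
  lra.
have -> : walk N m * rho - central N * (e * expR (- tau)) =
    rho * (walk N m - central N * e) + central N * (e * (rho - expR (- tau))).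
  by ring.
apply: (le_trans (ler_normD _ _)).
rewrite (normrM rho) (normrM (central N)) (normrM e).
rewrite (ger0_norm r0) (gtr0_norm c0) (ger0_norm e0).
apply: (@le_trans _ _ (12 * x / n * central N + central N * (12 / n))).
  apply: lerD; last by rewrite ler_wpM2l // ltW.
  by apply: le_trans IH; rewrite ler_piMl.
rewrite -natr1 -/x le_eqVlt; apply/orP; left; apply/eqP.
by field; apply: lt0r_neq0.
Qed.

End Gaussian.

(** * The local limit estimate with explicit constants *)

Section LocalLaw.
Variable R : realType.
Notation central := (@central R).
Notation walk := (@walk R).

(** Wallis' bounds put [pi * N * central N ^+ 2] within O(1/N) of 1; the difference of squares is
    then divided by a lower bound for the sum. *)
Lemma central_approx N (v : R) : (0 < N)%N -> N%:R <= v <= N%:R + 3 / 2 ->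
  `|central N - (Num.sqrt (pi * v))^-1| <= 6 / N%:R.
Proof.
move=> N0 /andP[Nv vN].
have n1 : 1 <= N%:R :> R by rewrite ler1n.
have up := wallis_le R N; have lo := wallis_ge R N.
have p2 := pi_ge2 R; have p4 := pihalf_lt2 R.
have c0 := central_gt0 R N.
move: (N%:R : R) (central N) (pi : R) n1 Nv vN up lo p2 p4 c0 {N0}.
move=> n c p n1 nv vn up lo p2 p4 c0.
have n0 : 0 < n by lra.
have v0 : 0 < v by lra.
have pv : 0 < p * v by rewrite mulr_gt0 //; lra.
set w := (Num.sqrt (p * v))^-1.
have w0 : 0 < w by rewrite invr_gt0 sqrtr_gt0.
have w2 : p * v * w ^+ 2 = 1.
  by rewrite /w exprVn sqr_sqrtr ?ltW // divff // lt0r_neq0.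
have c1 : c <= 1.
  have c2 : c ^+ 2 <= 1.
    apply: le_trans up; rewrite ler_peMl ?sqr_ge0 //.
    by rewrite -[1]mulr1; apply: ler_pM; lra.
  by rewrite -(@ler_pXn2r _ 2) ?nnegrE ?expr1n // ltW.
have i0 : 0 < n^-1 by rewrite invr_gt0.
have nn : n * n^-1 = 1 by rewrite divff // lt0r_neq0.
have pc : p * c ^+ 2 <= n^-1.
  by rewrite -[n^-1]mul1r ler_pdivlMr // mulrAC.
have pw : p * w ^+ 2 <= n^-1.
  rewrite -[n^-1]mul1r ler_pdivlMr // mulrAC -w2 ler_wpM2r ?sqr_ge0 //.
  by rewrite ler_wpM2l //; lra.
have pc0 : 0 <= p * c ^+ 2 by rewrite mulr_ge0 ?sqr_ge0 //; lra.
have pw0 : 0 <= p * w ^+ 2 by rewrite mulr_ge0 ?sqr_ge0 //; lra.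
have key : `|c - w| * (n * (p * (c + w))) <= 3 / 2 / n.
  have -> : `|c - w| * (n * (p * (c + w))) = `|p * n * c ^+ 2 - p * n * w ^+ 2|.
    have -> : p * n * c ^+ 2 - p * n * w ^+ 2 = (c - w) * (n * (p * (c + w))).
      by ring.
    by rewrite [RHS]normrM [X in _ = _ * X]gtr0_norm // !mulr_gt0 ?addr_gt0 //;
      lra.
  have vw : p * (v - n) * w ^+ 2 <= 3 / 2 * n^-1.
    rewrite mulrAC mulrC; apply: ler_pM => //; lra.
  have vw0 : 0 <= p * (v - n) * w ^+ 2 by rewrite !mulr_ge0 ?sqr_ge0 //; lra.
  rewrite ler_norml; apply/andP; split; lra.
(* A crude bound from [wallis_ge] and [c <= 1]; with [3 / 2] in [key] it yields the constant 6. *)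
have low : 1 / 4 <= n * (p * (c + w)).
  have c8 : 1 <= n * (8 * c).
    apply: (le_trans lo); rewrite expr2 mulrA.
    have : c * c <= 1 * c by rewrite ler_wpM2r // ltW.
    rewrite mul1r -[p * _ * c * c]mulrA => cc.
    have : p * (n + 2^-1) * (c * c) <= p * (n + 2^-1) * c.
      by rewrite ler_wpM2l // mulr_ge0; lra.
    have : p * (n + 2^-1) * c <= 4 * (2 * n) * c.
      apply: ler_wpM2r; first exact: ltW.
      apply: ler_pM; lra.
    lra.
  have : n * (2 * c) <= n * (p * (c + w)).
    apply: ler_wpM2l; first exact: ltW.
    apply: ler_pM; lra.
  lra.
have := ler_wpM2l (normr_ge0 (c - w)) low.
lra.
Qed.

Lemma law_gauss (b : bool) N k (n : R) : (4 <= N)%N -> (k.*2 <= N)%N ->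
  n = (N.*2 + b).+2%:R ->
  `|law R b N 0 k - 2 * Num.sqrt 2 / Num.sqrt (pi * n) *
      expR (- (2 * k%:R ^+ 2 / n))| <=
  2000 * (k.+1%:R / (n * Num.sqrt n) + n^-1).
Proof.
move=> N4 kN nE'; have nE : n = 2 * N%:R + 2 + b%:R.
  by rewrite nE' -!natr1 natrD -mul2n natrM; ring.
have b01 : 0 <= (b%:R : R) <= 1 by case: (b); rewrite /= ?lexx ?ler01.
have [b0 b1] := andP b01.
(* With this [v], the exponent [m ^+ 2 / (4 * v)] at [m = 2 * k] is [2 * k ^+ 2 / n]. *)
set v := n / 2; have nv : n = 2 * v by rewrite /v; field.
have vN : N%:R + 1 <= v <= N%:R + 3 / 2 by apply/andP; split; lra.
have N4' : 4 <= N%:R :> R by rewrite ler_nat.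
have N0 : (0 < N)%N by lia.
have n0 : 0 < n by lra.
set s := Num.sqrt n; have s0 : 0 < s by rewrite sqrtr_gt0.
have ss : s * s = n by rewrite -expr2 sqr_sqrtr // ltW.
have i0 : 0 < n^-1 by rewrite invr_gt0.
have is0 : 0 < s^-1 by rewrite invr_gt0.
(* Used for [M = N] and [M = N - k], where [k.*2 <= N] gives [n <= 9 * M]. *)
have scale M : n <= 9 * M%:R -> [/\ (0 < M)%N, M%:R^-1 <= 9 / n &
    central M <= 3 / s].
  move=> nM; have M0 : (0 < M)%N.
    by rewrite -(ltr_nat R); lra.
  have M0' : 0 < M%:R :> R by rewrite ltr0n.
  split => //.
    by rewrite ler_pdivlMr // mulrC ler_pdivrMr.
  apply: (le_trans (central_le R M0)).
  rewrite ler_pdivlMr // mulrC ler_pdivrMr ?sqrtr_gt0 //.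
  rewrite -(@ler_pXn2r _ 2) ?nnegrE ?mulr_ge0 ?sqrtr_ge0 ?(ltW s0) //.
  by rewrite exprMn (sqr_sqrtr (ltW n0)) sqr_sqrtr ?ler0n //; lra.
have kN' : 2 * k%:R <= N%:R :> R by rewrite -natrM mul2n ler_nat.
have k0 := ler0n R k.
have kN2 : (k <= N)%N by apply: leq_trans kN; rewrite -addnn leq_addr.
have MNk : n <= 9 * (N - k)%:R by rewrite natrB //; lra.
have MN : n <= 9 * N%:R by lra.
have [M0 Mi Mc] := scale _ MNk; have [_ Ni Nc] := scale _ MN.
(* By [scale] at [M = N - k], first differences are at most [3 * 9 / n] and second ones at most
   [4 * 3 * 9 / (n * s)]. *)
have law_w : `|law R b N 0 k - 2 * walk N k.*2| <=
    8 * (27 / n) + 6 * (108 / (n * s)) * k%:R.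
  have h1 M m : (N - k <= M)%N -> walk M m - walk M m.+1 <= 27 / n.
    move=> kM; have M1 : (0 < M)%N by exact: leq_trans kM.
    apply: (le_trans (walk_diff_le R m M1)).
    have : M%:R^-1 <= (N - k)%:R^-1 :> R.
      by rewrite lef_pV2 ?posrE ?ltr0n // ler_nat.
    lra.
  have h2 M m : (N - k <= M)%N ->
      `|walk M m - 2 * walk M m.+1 + walk M m.+2| <= 108 / (n * s).
    move=> kM; have M1 : (0 < M)%N by exact: leq_trans kM.
    apply: (le_trans (walk_diff2_le R m M1)).
    have E : 108 / (n * s) = (4 * (3 / s)) * (9 / n).
      by field; rewrite !lt0r_neq0.
    rewrite E; apply: ler_pM.
    - by rewrite mulr_ge0 // ltW // central_gt0.
    - by rewrite invr_ge0.
    - by rewrite ler_pM2l //; apply: le_trans Mc; exact: central_dec.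
    - apply: le_trans Mi; by rewrite lef_pV2 ?posrE ?ltr0n // ler_nat.
  have := @law_walk R b (N - k) _ _ M0 h1 h2 N 0 k.
  rewrite addn0 subnK // add0n => /(_ (leqnn N)) /le_trans; apply.
  rewrite mulr_natr lerD2r -[2 * _ *+ _]mulr_natr.
  have : (0 < k)%:R <= 1 :> R by case: (0 < k)%N; rewrite /= ?ler01.
  have g0 : 0 <= 27 / n by rewrite divr_ge0 // ltW.
  move: (27 / n) g0 ((0 < k)%:R : R) => g g0 c c1.
  have : g * c <= g * 1 by rewrite ler_wpM2l.
  lra.
have gauss : `|walk N k.*2 - central N * expR (- (2 * k%:R ^+ 2 / n))| <=
    12 * (2 * k%:R) * (9 / n) * (3 / s).
  have := walk_gauss N0 kN vN; rewrite -mul2n natrM.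
  have -> : (2 * k%:R) ^+ 2 / (4 * v) = 2 * k%:R ^+ 2 / n.
    rewrite nv; field; apply: lt0r_neq0; lra.
  move=> /le_trans; apply; apply: ler_pM => //;
    first [ by rewrite !mulr_ge0 ?invr_ge0 // | exact/ltW/central_gt0
    | by apply: ler_wpM2l => //; rewrite !mulr_ge0 ].
have const : `|central N - (Num.sqrt (pi * v))^-1| <= 54 / n.
  have vN' : N%:R <= v <= N%:R + 3 / 2 by apply/andP; split; lra.
  apply: (le_trans (central_approx N0 vN')); lra.
have e0 : 0 <= expR (- (2 * k%:R ^+ 2 / n)) by rewrite expR_ge0.
have e1 : expR (- (2 * k%:R ^+ 2 / n)) <= 1.
  rewrite -[leRHS](@expR0 R) ler_expR oppr_le0.
  by rewrite divr_ge0 ?mulr_ge0 ?sqr_ge0 // ltW.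
have cE : 2 * Num.sqrt 2 / Num.sqrt (pi * n) = 2 * (Num.sqrt (pi * v))^-1.
  have p0 := pi_gt0 R; have v0 : 0 < v by lra.
  by rewrite nv mulrCA sqrtrM // invfM -mulrA mulVKf // lt0r_neq0 // sqrtr_gt0.
rewrite cE.
move: (expR _) e0 e1 gauss => e e0 e1 gauss.
move: (Num.sqrt (pi * v))^-1 const => w const.
have -> : law R b N 0 k - 2 * w * e = (law R b N 0 k - 2 * walk N k.*2) +
  2 * (walk N k.*2 - central N * e) + 2 * ((central N - w) * e) by ring.
apply: (le_trans (ler_normD _ _)).
apply: (le_trans (lerD (ler_normD _ _) (lexx _))).
rewrite [X in _ + X + _]normrM [X in _ + _ + X]normrM (normrM _ e).
rewrite (ger0_norm e0) !(@ger0_norm _ 2) //.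
have const' : `|central N - w| * e <= 54 / n * 1 by apply: ler_pM.
have E : (n * s)^-1 = n^-1 * s^-1 by rewrite invfM.
rewrite -natr1 E; rewrite E in law_w.
have ns0 : 0 <= n^-1 * s^-1 by rewrite mulr_ge0 // ltW.
have kns0 : 0 <= k%:R * (n^-1 * s^-1) by rewrite mulr_ge0.
have gauss' : `|walk N k.*2 - central N * e| <= 648 * (k%:R * (n^-1 * s^-1)).
  apply: (le_trans gauss); rewrite le_eqVlt; apply/orP; left; apply/eqP.
  by ring.
have law_w' : `|law R b N 0 k - 2 * walk N k.*2| <=
    216 * n^-1 + 648 * (k%:R * (n^-1 * s^-1)).
  apply: (le_trans law_w); rewrite le_eqVlt; apply/orP; left; apply/eqP.
  by ring.
(* The errors add up to [648 + 2 * 648 = 1944] times the first term and [216 + 2 * 54 = 324] times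
   the last, both below 2000. *)
rewrite [leRHS](_ : _ = 2000 * (k%:R * (n^-1 * s^-1)) + 2000 * (n^-1 * s^-1)
  + 2000 * n^-1); last by ring.
lra.
Qed.

End LocalLaw.

(** * Transfer to the uniform measure *)

Section UniformMeasure.
Variable R : realType.

Lemma card_fset_sp L (A : set intpart) :
  #|` fset_set (A `&` [set l : intpart | sp l = L.+2])| =
  count (fun w => part_of_word w \in A) (words L).
Proof.
have fA : finite_set (A `&` [set l : intpart | sp l = L.+2]).
  exact/finite_setIr/finite_sp.
rewrite -size_filter -(size_map part_of_word); apply: perm_size.
apply: uniq_perm; first exact: fset_uniq.
  rewrite map_inj_uniq; last exact: part_of_word_inj.
  by rewrite filter_uniq // words_uniq.
move=> l; rewrite in_fset_set //.
apply/idP/idP => [|/mapP[w + ->]].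
  rewrite inE => -[Al /= spl].
  have [|w lw] := @part_of_word_surj l; first by rewrite spl.
  rewrite lw; apply: map_f; rewrite mem_filter mem_words -lw mem_set //=.
  by move: spl; rewrite lw sp_part_of_word => -[->].
rewrite mem_filter mem_words => /andP[/set_mem Aw /eqP wL].
by rewrite inE; split => //=; rewrite sp_part_of_word wL.
Qed.

Lemma unif_sp_words L (A : set intpart) : unif_sp R L.+2 A =
  ((2 ^+ L)^-1 * \sum_(w <- words L) (part_of_word w \in A)%:R)%:E.
Proof.
rewrite unif_spE; last first.
  by exists (part_of_word (nseq L true)); rewrite /= sp_part_of_word size_nseq.
have tot : #|` fset_set [set l : intpart | sp l = L.+2]| = (2 ^ L)%N.
  rewrite -[X in fset_set X]setTI card_fset_sp -size_words -count_predT.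
  by apply: eq_count => w /=; rewrite in_setT.
rewrite tot card_fset_sp mulrC natrX -sum1_count natr_sum big_mkcond.
by congr (_ * _)%:E; apply: eq_bigr => w _; case: ifP.
Qed.

Lemma integral_unif_sp L (f : intpart -> R) : (forall l, 0 <= f l) ->
  (\int[unif_sp R L.+2]_l (f l)%:E =
   ((2 ^+ L)^-1 * \sum_(w <- words L) f (part_of_word w))%:E)%E.
Proof.
move=> f0.
have p0 : 0 <= (2 ^+ L)^-1 :> R by rewrite invr_ge0 exprn_ge0.
(* Written as a scaled finite sum of Dirac masses, the measure turns the integral into a sum. *)
pose D i : {measure set intpart -> \bar R} :=
  dirac (part_of_word (nth [::] (words L) i)).
have -> : unif_sp R L.+2 = mscale (NngNum p0) (msum D (2 ^ L)).
  apply/funext => A; rewrite unif_sp_words /mscale /msum /= EFinM.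
  congr (_ * _)%E; rewrite (big_nth [::]) size_words big_mkord -sumEFin.
  by apply: eq_bigr => i _; rewrite /D /= diracE.
rewrite ge0_integral_mscale //; last by move=> l _; rewrite lee_fin.
rewrite ge0_integral_measure_sum //; last by move=> l _; rewrite lee_fin.
rewrite /= EFinM; congr (_ * _)%E.
rewrite (big_nth [::]) size_words big_mkord -sumEFin.
apply: eq_bigr => i _; rewrite integral_dirac //.
by rewrite diracT mul1e.
Qed.

End UniformMeasure.

Section Transfer.
Variables (R : realType) (b : bool) (N : nat).
Let L := (N.*2 + b)%N.

Let mean_words (phi : nat -> R) :
  (2 ^+ L)^-1 * \sum_(w <- words L) phi (ds (part_of_word w)) =
  mean_ds b N 0 phi.
Proof. by rewrite mulrC sum_ds_words. Qed.

Lemma unif_sp_ds (A : pred nat) :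
  unif_sp R L.+2 [set l : intpart | A (ds l)] =
  (mean_ds b N 0 (fun k => (A k)%:R))%:E.
Proof.
rewrite unif_sp_words -mean_words; congr (_ * _)%:E.
apply: eq_bigr => w _; congr (nat_of_bool _)%:R.
by apply/idP/idP => [/set_mem//|H]; exact: mem_set.
Qed.

Lemma unif_sp_ds_eq k : unif_sp R L.+2 [set l : intpart | ds l = k] =
  (law R b N 0 k)%:E.
Proof.
rewrite -mean_ds_indicator -(unif_sp_ds (fun j => j == k)).
by congr unif_sp; apply/seteqP; split => l /= /eqP.
Qed.

Lemma expectation_ds : ('E_(unif_sp R L.+2)[ds_RV R] =
  ((N%:R + (~~ b)%:R) * central R N)%:E)%E.
Proof.
rewrite unlock integral_unif_sp; last by move=> l; rewrite /ds_RV.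
by rewrite (mean_words (fun k => k%:R)) mean_ds_id.
Qed.

Lemma variance_ds : (0 < N)%N ->
  let mu := (N%:R + (~~ b)%:R) * central R N in
  ('V_(unif_sp R L.+2)[ds_RV R] =
    ((N%:R - 1) / 2 + (~~ b)%:R + mu - mu ^+ 2)%:E)%E.
Proof.
move=> N0 mu; rewrite /variance covariance.unlock expectation_ds /=.
rewrite -/mu [in LHS]unlock.
rewrite (integral_unif_sp L
  (f := fun l => (ds_RV R l - mu) * (ds_RV R l - mu)));
  last by move=> l; rewrite -expr2 sqr_ge0.
rewrite (mean_words (fun k => (k%:R - mu) * (k%:R - mu))); congr (_%:E).
have -> : (fun k => (k%:R - mu) * (k%:R - mu)) = (fun k =>
   k%:R * (k%:R - 1) + ((1 - 2 * mu) * k%:R + mu ^+ 2 * 1)) :> (nat -> R).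
  by apply/funext => k; ring.
rewrite !mean_dsD !mean_dsZ mean_ds_falling2 // mean_ds_id mean_ds_total -/mu.
by ring.
Qed.

Lemma cdf_scaled_ds (x : R) :
  cdf (scaled_ds_RV R L.+2 : {RV (unif_sp R L.+2) >-> R}) x =
  (mean_ds b N 0 (fun k => (k%:R / Num.sqrt (L.+2)%:R <= x :> R)%:R))%:E.
Proof.
rewrite -(unif_sp_ds (fun k => k%:R / Num.sqrt (L.+2)%:R <= x :> R)).
by rewrite /cdf /distribution /pushforward; congr unif_sp.
Qed.

End Transfer.

(** * Asymptotics of the mean and the variance *)

Section Moments.
Variable R : realType.

Lemma mean_approx (b : bool) N (n : R) : (2 <= N)%N -> n = (N.*2 + b).+2%:R ->
  `|(N%:R + (~~ b)%:R) * central R N - Num.sqrt (n / (2 * pi))| <= 15.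
Proof.
move=> N2 nE'; have nE : n = 2 * N%:R + 2 + b%:R.
  by rewrite nE' -!natr1 natrD -mul2n natrM; ring.
have N2' : 2 <= N%:R :> R by rewrite ler_nat.
have N0 : (0 < N)%N by lia.
have bE : (b%:R : R) = 1 - (~~ b)%:R by case: b {nE nE'} => /=; ring.
have e0 : 0 <= ((~~ b)%:R : R) <= 1 by case: (b); rewrite /= ?lexx ?ler01.
have p0 := pi_gt0 R; have p2 := pi_ge2 R.
set v := n / 2; have nv : n = 2 * v by rewrite /v; field.
have vN : N%:R <= v <= N%:R + 3 / 2 by apply/andP; split; lra.
have v0 : 0 < v by lra.
have := central_approx N0 vN.
(* This matches [(N + eps) * central N] factor by factor: the first factors differ by O(1), the
   second ones by O(1/N). *)
have -> : Num.sqrt (n / (2 * pi)) = v * (Num.sqrt (pi * v))^-1.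
  have -> : n / (2 * pi) = v ^+ 2 / (pi * v).
    rewrite nv; move: (pi : R) p0 => p p0.
    by field; rewrite (lt0r_neq0 p0) (lt0r_neq0 v0).
  rewrite sqrtrM ?sqr_ge0 // sqrtr_sqr gtr0_norm // sqrtrV //.
  by rewrite mulr_ge0 // ltW.
have w1 : 0 <= (Num.sqrt (pi * v))^-1 <= 1.
  have pv1 : 1 <= pi * v by rewrite -[leLHS]mulr1; apply: ler_pM; lra.
  have pv0 : 0 < pi * v by lra.
  have sq1 : 1 <= Num.sqrt (pi * v) by rewrite -[leLHS]sqrtr1 ler_wsqrtr.
  by rewrite invr_ge0 sqrtr_ge0 /= invf_le1 // (lt_le_trans ltr01).
move: (Num.sqrt _)^-1 w1 (central R N) => w /andP[w0 w1] c cw.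
have [e0' e1'] := andP e0; move: (~~ b)%:R bE e0' e1' => e bE e0' e1'.
have -> : (N%:R + e) * c - v * w = (N%:R + e) * (c - w) + (N%:R + e - v) * w.
  by ring.
apply: (le_trans (ler_normD _ _)); rewrite !normrM (ger0_norm w0).
have h1 : `|N%:R + e| <= 3 / 2 * N%:R by rewrite ger0_norm; lra.
have h2 : `|N%:R + e - v| <= 3 / 2 by rewrite ler_norml; apply/andP; split; lra.
have k1 : `|N%:R + e| * `|c - w| <= 3 / 2 * N%:R * (6 / N%:R) by apply: ler_pM.
have k2 : `|N%:R + e - v| * w <= 3 / 2 * 1 by apply: ler_pM.
have : 3 / 2 * N%:R * (6 / N%:R) = 9 :> R by field; apply: lt0r_neq0; lra.
lra.
Qed.

Lemma variance_approx (b : bool) N (n mu : R) : (2 <= N)%N ->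
  n = (N.*2 + b).+2%:R -> mu = (N%:R + (~~ b)%:R) * central R N ->
  `|(N%:R - 1) / 2 + (~~ b)%:R + mu - mu ^+ 2 - (1 / 4 - 1 / (2 * pi)) * n|
    <= 300 * Num.sqrt n.
Proof.
move=> N2 nE' muE; have := mean_approx N2 nE'; rewrite -muE {muE}.
have nE : n = 2 * N%:R + 2 + b%:R.
  by rewrite nE' -!natr1 natrD -mul2n natrM; ring.
have N2' : 2 <= N%:R :> R by rewrite ler_nat.
have b01 : 0 <= (b%:R : R) <= 1 by case: (b); rewrite /= ?lexx ?ler01.
have e0 : 0 <= ((~~ b)%:R : R) <= 1 by case: (b); rewrite /= ?lexx ?ler01.
have p0 := pi_gt0 R; have p2 := pi_ge2 R.
have n1 : 1 <= n by lra.
have s1 : 1 <= Num.sqrt n by rewrite -[leLHS]sqrtr1 ler_wsqrtr.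
set s := Num.sqrt (n / (2 * pi)).
have s0 : 0 <= s by rewrite sqrtr_ge0.
have q : 0 <= n / (2 * pi) by rewrite divr_ge0 ?mulr_ge0 //; lra.
have ss : s * s = n / (2 * pi) by rewrite -expr2 sqr_sqrtr.
have sn : s <= Num.sqrt n.
  apply: ler_wsqrtr.
  by rewrite ler_pdivrMr ?mulr_gt0 // ler_peMr //; lra.
move: mu => m; rewrite -/s ler_norml => /andP[m1 m2].
have -> : (1 / 4 - 1 / (2 * pi)) * n = n / 4 - s * s.
  rewrite ss; move: (pi : R) p0 => p p0'.
  by field; rewrite (lt0r_neq0 p0').
(* Since [m] is within 15 of [s], the squares differ by O(s), which is O(sqrt n). *)
have d : `|m ^+ 2 - s * s| <= 15 * (2 * s + 15).
  have -> : m ^+ 2 - s * s = (m - s) * (m + s) by ring.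
  rewrite normrM; apply: ler_pM => //.
    by rewrite ler_norml; apply/andP; split; lra.
  by rewrite ler_norml; apply/andP; split; lra.
move: d; rewrite !ler_norml => /andP[d1 d2].
have [b0 b1] := andP b01; have [e0' e1'] := andP e0.
by apply/andP; split; lra.
Qed.

End Moments.

(** * Convergence in distribution *)

Section HalfNormal.
Variable R : realType.
Notation pdf := (half_normal_pdf (2^-1 : R)).
Notation prob := (half_normal_prob (2^-1 : R)%:pos).
Notation mu := (@lebesgue_measure R).

Lemma half_normal_pdfE (x : R) : 0 <= x ->
  pdf x = 2 * Num.sqrt 2 / Num.sqrt pi * expR (- (2 * x ^+ 2)).
Proof.
move=> x0; rewrite /half_normal_pdf x0 invrK sqrtrM // sqrtrV ?pi_ge0 //.
rewrite mulrA; congr (_ * expR (- _)).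
by field.
Qed.

Lemma half_normal_pdf_ninc (x y : R) : 0 <= x -> x <= y -> pdf y <= pdf x.
Proof.
move=> x0 xy; rewrite !half_normal_pdfE ?(le_trans x0) //.
apply: ler_wpM2l; first by rewrite divr_ge0 ?mulr_ge0 ?sqrtr_ge0.
by rewrite ler_expR lerN2 ler_wpM2l // ler_pXn2r ?nnegrE // (le_trans x0).
Qed.

Let mpdf (D : set R) : measurable_fun D (fun x => (pdf x)%:E).
Proof.
apply/measurable_EFinP/measurable_funTS.
exact: (measurable_half_normal_pdf (2^-1)%:pos).
Qed.

Let pdf0 (x : R) : (0 <= (pdf x)%:E)%E.
Proof. by rewrite lee_fin (half_normal_pdf_ge0 (2^-1)%:pos). Qed.

Definition half_normal_cdf (x : R) : R := fine (prob `]-oo, x]%classic).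

Lemma half_normal_cdfE x : prob `]-oo, x]%classic = (half_normal_cdf x)%:E.
Proof. by rewrite fineK // fin_num_measure. Qed.

Lemma half_normal_cdf_le0 x : x <= 0 -> half_normal_cdf x = 0.
Proof.
move=> x0; rewrite /half_normal_cdf /half_normal_prob.
rewrite -(@integral_setD1 _ _ x) //; last first.
  exact: measurableD.
rewrite integral0_eq // => y [/=]; rewrite in_itv /= => yx /eqP xy.
rewrite /half_normal_pdf leNgt (lt_le_trans _ x0) //.
by rewrite lt_neqAle yx xy.
Qed.

Lemma half_normal_cdf_itv u v : 0 <= u -> u <= v ->
  pdf v * (v - u) <= half_normal_cdf v - half_normal_cdf u <= pdf u * (v - u).
Proof.
move=> u0 uv.
have E : (prob `]-oo, v]%classic =
    prob `]-oo, u]%classic + prob `]u, v]%classic)%E.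
  rewrite -measureU //; last first.
    apply/seteqP; split => // y [] /=; rewrite !in_itv /= => yu /andP[].
    by rewrite ltNge yu.
  congr (prob _); apply/seteqP; split => y /=; rewrite !in_itv /=.
    move=> yv; case: (leP y u) => yu; [by left|by right; apply/andP].
  by move=> [yu|/andP[] //]; exact: le_trans uv.
have fin : prob `]u, v]%classic = (fine (prob `]u, v]%classic))%:E.
  by rewrite fineK // fin_num_measure.
have muv : mu `]u, v]%classic = (v - u)%:E.
  rewrite lebesgue_measure_itv /= lte_fin; case: ltP => // vu.
  by rewrite (_ : v = u) ?subrr //; apply/le_anti/andP.
have -> : half_normal_cdf v - half_normal_cdf u = fine (prob `]u, v]%classic).
  apply/eqP; rewrite subr_eq addrC; apply/eqP/EFin_inj.
  by rewrite EFinD -fin -!half_normal_cdfE.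
have cst_int c : ((c * (v - u))%:E =
    \int[mu]_(y in `]u, v]%classic) cst c%:E y)%E.
  by rewrite integral_cst // EFinM -muv.
have pdfs y : u < y -> y <= v -> pdf v <= pdf y <= pdf u.
  move=> uy yv; have y0 : 0 <= y by rewrite ltW // (le_lt_trans u0).
  by rewrite !half_normal_pdf_ninc // ltW.
apply/andP; split; rewrite -lee_fin -fin cst_int.
  apply: ge0_le_integral.
  - exact: measurable_itv.
  - by move=> y _; exact: pdf0.
  - exact: measurable_cst.
  - exact: mpdf.
  - move=> y; rewrite /= in_itv /= => /andP[uy yv]; rewrite lee_fin.
    by have /andP[] := pdfs y uy yv.
apply: ge0_le_integral.
- exact: measurable_itv.
- by move=> y _; exact: pdf0.
- exact: mpdf.
- exact: measurable_cst.
- move=> y; rewrite /= in_itv /= => /andP[uy yv]; rewrite lee_fin.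
  by have /andP[] := pdfs y uy yv.
Qed.

(** The density being nonincreasing, a left-endpoint rectangle exceeds its integral by at most [eta]
    times the drop of the density, and the drops telescope. *)
Lemma riemann_sum K (eta : R) : 0 < eta ->
  half_normal_cdf (K%:R * eta) <= \sum_(k < K) eta * pdf (k%:R * eta)
    <= half_normal_cdf (K%:R * eta) + eta * (pdf 0 - pdf (K%:R * eta)).
Proof.
move=> eta0; elim: K => [|K /andP[IH1 IH2]].
  by rewrite big_ord0 mul0r subrr mulr0 half_normal_cdf_le0 ?addr0 ?lexx.
rewrite big_ord_recr /=.
have u0 : 0 <= K%:R * eta by rewrite mulr_ge0 // ltW.
have D : K.+1%:R * eta - K%:R * eta = eta by rewrite -natr1; ring.
have uv : K%:R * eta <= K.+1%:R * eta by lra.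
have := half_normal_cdf_itv u0 uv; rewrite D => /andP[h1 h2].
by apply/andP; split; lra.
Qed.

Lemma riemann_sum_approx K (eta x : R) : 0 < eta -> 0 <= x ->
  x <= K%:R * eta <= x + eta ->
  `|\sum_(k < K) eta * pdf (k%:R * eta) - half_normal_cdf x| <= 2 * eta * pdf 0.
Proof.
move=> eta0 x0 /andP[xK Kx]; have /andP[r1 r2] := riemann_sum K eta0.
have /andP[h1 h2] := half_normal_cdf_itv x0 xK.
have p0 y : 0 <= pdf y := half_normal_pdf_ge0 (2^-1)%:pos y.
have px := half_normal_pdf_ninc (lexx 0) x0.
have q1 : pdf x * (K%:R * eta - x) <= pdf 0 * eta.
  by apply: ler_pM => //; first [exact: p0 | lra].
have q2 : 0 <= pdf (K%:R * eta) * (K%:R * eta - x).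
  by apply: mulr_ge0; rewrite ?p0 ?subr_ge0.
have q3 : 0 <= eta * pdf (K%:R * eta) by apply: mulr_ge0; rewrite ?p0 // ltW.
have q4 : 0 <= eta * pdf 0 by apply: mulr_ge0; rewrite ?p0 // ltW.
by rewrite ler_norml; apply/andP; split; lra.
Qed.

End HalfNormal.

(** * Local law and distribution functions for the uniform measure *)

Section Assembly.
Variable R : realType.
Notation pdf := (half_normal_pdf (2^-1 : R)).

Lemma split_semiperimeter n : (2 <= n)%N ->
  n = ((n - 2)./2.*2 + odd (n - 2)).+2.
Proof. by move=> n2; have := odd_double_half (n - 2); lia. Qed.

Lemma half_lower n : (10 <= n)%N -> (4 <= (n - 2)./2)%N.
Proof.
move=> n10; apply: (@half_leq 8); rewrite leq_subRL //.
exact: leq_trans n10.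
Qed.

Lemma half_upper n : (2 <= n)%N -> (n <= (n - 2)./2.*2 + 3)%N.
Proof.
move=> n2; rewrite {1}(split_semiperimeter n2).
by case: odd; rewrite ?addn1 ?addn0 addn3.
Qed.

Lemma powRN32 (x : R) : 0 < x -> x `^ (- (3 / 2)) = (x * Num.sqrt x)^-1.
Proof.
move=> x0; have -> : - (3 / 2) = - (1 + 2^-1) :> R by field.
rewrite powRN powRD; last by rewrite (lt0r_neq0 x0) implybT.
by rewrite powRr1 ?ltW // powR12_sqrt // ltW.
Qed.

Lemma ln_le_sqrt (x : R) : 1 <= x -> ln x <= 2 * Num.sqrt x.
Proof.
move=> x1; have s0 : 0 < Num.sqrt x by rewrite sqrtr_gt0 (lt_le_trans ltr01).
have -> : ln x = 2 * ln (Num.sqrt x).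
  rewrite -[in LHS](@sqr_sqrtr _ x) ?(le_trans ler01) // expr2 lnM ?posrE //.
  by ring.
rewrite ler_pM2l //; have := expR_ge1Dx (ln (Num.sqrt x)).
by rewrite lnK ?posrE // => /(le_trans _); apply; rewrite lerDr.
Qed.

Lemma local_law n k : (10 <= n)%N -> (k.*2 <= (n - 2)./2)%N ->
  exists p : R, unif_sp R n [set l | ds l = k] = p%:E /\
  `|p - 2 * Num.sqrt 2 / Num.sqrt (pi * n%:R) *
        expR (- (2 * k%:R ^+ 2 / n%:R))| <=
  2000 * (k.+1%:R * n%:R `^ (- (3 / 2)) + n%:R^-1).
Proof.
move=> n10 kn; have n2 := leq_trans (isT : 2 <= 10)%N n10.
set N := (n - 2)./2 in kn *; set b := odd (n - 2).
have nE : n = (N.*2 + b).+2 := split_semiperimeter n2.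
exists (law R b N 0 k); split; first by rewrite {1}nE unif_sp_ds_eq.
rewrite powRN32 ?ltr0n; last exact: leq_trans n2.
by apply: law_gauss; [exact: half_lower|exact: kn|rewrite -nE].
Qed.

(** As [ln n <= 2 * sqrt n], for [n >= 400] one has [sqrt (n * ln n) <= (n - 3) / 2], which with
    [k0 < 1 / 2] puts [k] in the range of [law_gauss]. *)
Lemma local_law_range n k (k0 : R) : (400 <= n)%N -> k0 < 1 / 2 ->
  k%:R <= k0 * Num.sqrt (n%:R * ln n%:R) -> (k.*2 <= (n - 2)./2)%N.
Proof.
move=> n400 k0h kle.
have n400' : 400 <= n%:R :> R by rewrite ler_nat.
have x0 : 0 < n%:R :> R by lra.
set s := Num.sqrt (n%:R : R).
have s20 : 20 <= s.
  rewrite -[20](@ger0_norm R) // -sqrtr_sqr ler_wsqrtr //.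
  by apply: le_trans n400'; lra.
have ss : s ^+ 2 = n%:R by rewrite sqr_sqrtr // ltW.
have l0 : 0 <= ln (n%:R : R) by rewrite ln_ge0 //; lra.
have ln_s : ln (n%:R : R) <= 2 * s by apply: ln_le_sqrt; lra.
set q := Num.sqrt (n%:R * ln n%:R) in kle.
have q0 : 0 <= q by rewrite sqrtr_ge0.
have y0 : 0 <= (s ^+ 2 - 3) / 2 by rewrite ss; lra.
have qs : q <= (s ^+ 2 - 3) / 2.
  rewrite -[leRHS]ger0_norm // -sqrtr_sqr ler_wsqrtr //.
  apply: (@le_trans _ _ (s ^+ 2 * (2 * s))).
    by rewrite ss ler_wpM2l // ltW.
  rewrite -subr_ge0.
  rewrite (_ : _ - _ = (s ^+ 2 * (s * (s - 8) - 6) + 9) / 4); last by field.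
  have : 20 * 12 <= s * (s - 8) by apply: ler_pM; lra.
  move=> h; rewrite divr_ge0 // addr_ge0 // mulr_ge0 ?sqr_ge0 //; lra.
have kq : k0 * q <= 1 / 2 * q by rewrite ler_wpM2r // ltW.
have := half_upper (leq_trans (isT : 2 <= 400)%N n400).
rewrite -(ler_nat R) natrD -muln2 natrM -ss => nN.
by rewrite -muln2 -(ler_nat R) natrM; lra.
Qed.

Lemma mean_ds_cdf (b : bool) N (x s : R) : 0 <= x -> 0 < s ->
  mean_ds b N 0 (fun k => (k%:R / s <= x :> R)%:R) =
  \sum_(k < (Num.truncn (x * s)).+1) law R b N 0 k.
Proof.
move=> x0 s0; have xs : 0 <= x * s by rewrite mulr_ge0 // ltW.
under eq_bigr do rewrite -mean_ds_indicator.
rewrite -mean_ds_sum; congr mean_ds; apply/funext => j.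
by rewrite sum_indicator ltnS truncn_ge_nat // ler_pdivrMr.
Qed.

(** The main terms of the local law form the Riemann sum of mesh [1 / sqrt n]; the remaining error
    comes from at most [(x + 1) * sqrt n] terms, each at most [2000 * (x + 2) / n]. *)
Lemma cdf_bound n (x : R) : (10 <= n)%N -> 0 <= x ->
  4 * x + 3 <= Num.sqrt n%:R ->
  exists F : R,
    cdf (scaled_ds_RV R n : {RV (unif_sp R n) >-> R}) x = F%:E /\
    `|F - half_normal_cdf x| <=
      (2000 * (x + 1) * (x + 2) + 2 * pdf 0) / Num.sqrt n%:R.
Proof.
move=> n10 x0 xs; have n2 := leq_trans (isT : 2 <= 10)%N n10.
set N := (n - 2)./2; set b := odd (n - 2).
have nE : n = (N.*2 + b).+2 := split_semiperimeter n2.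
have n0 : 0 < n%:R :> R by rewrite ltr0n (leq_trans _ n2).
have s0 : 0 < Num.sqrt (n%:R : R) by rewrite sqrtr_gt0.
have ss : Num.sqrt n%:R ^+ 2 = n%:R :> R by rewrite sqr_sqrtr // ltW.
exists (\sum_(k < (Num.truncn (x * Num.sqrt n%:R)).+1) law R b N 0 k); split.
  have C := @cdf_scaled_ds R b N x; rewrite -nE in C.
  by rewrite C mean_ds_cdf.
have nN : n%:R <= 2 * N%:R + 3 :> R.
  rewrite {1}nE -!natr1 natrD -mul2n natrM.
  by case: (b) => /=; lra.
move: (Num.sqrt _) xs s0 ss => s xs s0 ss.
have sE : Num.sqrt n%:R = s by rewrite -ss sqrtr_sqr gtr0_norm.
have xs0 : 0 <= x * s by rewrite mulr_ge0 // ltW.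
have s1 : 1 <= s by lra.
have /andP[t1 t2] := truncn_itv xs0.
set K := (Num.truncn (x * s)).+1 in t2 *.
have i0 : 0 < s^-1 by rewrite invr_gt0.
have main k : 2 * Num.sqrt 2 / Num.sqrt (pi * n%:R) *
    expR (- (2 * k%:R ^+ 2 / n%:R)) = s^-1 * pdf (k%:R * s^-1).
  rewrite half_normal_pdfE ?mulr_ge0 ?(ltW i0) // -ss sqrtrM ?pi_ge0 //.
  rewrite sqrtr_sqr gtr0_norm // invfM exprMn exprVn !mulrA.
  by move: (expR _) (Num.sqrt pi)^-1 => e p; ring.
have err (k : 'I_K) : `|law R b N 0 k - s^-1 * pdf (k%:R * s^-1)| <=
    2000 * (x + 2) / n%:R.
  have kx : k%:R <= x * s by rewrite -truncn_ge_nat // -ltnS.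
  have kN : (k.*2 <= N)%N.
    (* This gives [4 * k <= n - 3], and [n - 3 <= 2 * N]. *)
    have xs2 : (4 * x + 3) * s <= s * s by rewrite ler_wpM2r // ltW.
    by rewrite -muln2 -(ler_nat R) natrM; rewrite expr2 in ss; lra.
  have N4 := half_lower n10.
  have := law_gauss N4 kN (congr1 _ nE : n%:R = _ :> R).
  rewrite main sE => /le_trans; apply.
  have k1 : k.+1%:R / (n%:R * s) <= (x + 1) / n%:R.
    rewrite invfM mulrA ler_pdivrMr // mulrAC ler_wpM2r ?invr_ge0 ?ler0n //.
    by rewrite -natr1; lra.
  have -> : 2000 * (x + 2) / n%:R = 2000 * ((x + 1) / n%:R + n%:R^-1) by ring.
  by apply: ler_wpM2l; [exact: ler0n|rewrite lerD2r].
have tri : \sum_(k < K) law R b N 0 k - half_normal_cdf x =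
    \sum_(k < K) (law R b N 0 k - s^-1 * pdf (k%:R * s^-1)) +
    (\sum_(k < K) s^-1 * pdf (k%:R * s^-1) - half_normal_cdf x).
  by rewrite sumrB addrA subrK.
rewrite tri; apply: (le_trans (ler_normD _ _)); rewrite mulrDl; apply: lerD.
  apply: (le_trans (ler_norm_sum _ _ _)).
  apply: (le_trans (ler_sum _ (fun k _ => err k))).
  rewrite sumr_const card_ord -[leLHS]mulr_natr -ss.
  have Kx : K%:R <= (x + 1) * s by rewrite -natr1; lra.
  have -> : 2000 * (x + 1) * (x + 2) / s =
      2000 * (x + 2) / s ^+ 2 * ((x + 1) * s).
    by field; apply: lt0r_neq0.
  apply: ler_wpM2l; last exact: Kx.
  by apply: divr_ge0; [apply: mulr_ge0; [exact: ler0n|lra]|exact: sqr_ge0].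
rewrite mulrAC; apply: riemann_sum_approx => //; apply/andP; split.
  by rewrite ler_pdivlMr // ltW.
by rewrite ler_pdivrMr // mulrDl mulVf ?lt0r_neq0 // -natr1 lerD2r.
Qed.

Lemma cvg_cdf_scaled_ds (x : R) :
  cdf (scaled_ds_RV R n : {RV (unif_sp R n) >-> R}) x @[n --> \oo] -->
  (half_normal_cdf x)%:E.
Proof.
have [x0|x0] := ltP x 0.
  rewrite half_normal_cdf_le0 ?ltW //.
  apply: cvg_near_cst; exists 2%N => // n /= n2.
  have := @cdf_scaled_ds R (odd (n - 2)) (n - 2)./2 x.
  rewrite -split_semiperimeter // => E; apply: (etrans E).
  congr (_%:E); apply: mean_ds_vanish => k _.
  by rewrite leNgt (lt_le_trans x0) // divr_ge0 ?sqrtr_ge0.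
set A := 2000 * (x + 1) * (x + 2) + 2 * pdf 0.
have A0 : 0 <= A.
  apply: addr_ge0.
    by apply: mulr_ge0; [apply: mulr_ge0; [exact: ler0n|lra]|lra].
  by apply: mulr_ge0; [exact: ler0n|exact: (half_normal_pdf_ge0 (2^-1)%:pos)].
have large (M : R) : 0 <= M -> \forall n \near \oo,
    (10 <= n)%N /\ M <= Num.sqrt n%:R.
  move=> M0; exists (10 + (Num.truncn (M ^+ 2)).+1)%N => // n /= nM; split.
    exact: leq_trans (leq_addr _ _) nM.
  rewrite -[M]ger0_norm // -sqrtr_sqr ler_wsqrtr //.
  have /andP[_ /ltW h] := truncn_itv (sqr_ge0 M).
  by apply: (le_trans h); rewrite ler_nat (leq_trans _ nM) // leq_addl.
have x3 : 0 <= 4 * x + 3 by lra.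
apply/fine_cvgP; split.
  apply: filterS (large _ x3) => n [n10 xn].
  by have [F [-> _]] := cdf_bound n10 x0 xn.
apply/cvgrPdist_le => e e0.
have Ae : 0 <= A / e by rewrite divr_ge0 // ltW.
apply: filterS (large _ (addr_ge0 x3 Ae)) => n [n10 xn].
have [|F [FE Fb]] := cdf_bound n10 x0; first by lra.
change (`|half_normal_cdf x -
  fine (cdf (scaled_ds_RV R n : {RV (unif_sp R n) >-> R}) x)| <= e).
rewrite FE distrC -/A in Fb *; apply: (le_trans Fb).
rewrite ler_pdivrMr; last by lra.
by rewrite [e * _]mulrC -ler_pdivrMr //; lra.
Qed.

End Assembly.

Theorem proposition4p6 (R : realType) :
  [/\ cvg_in_distribution
        (fun n => scaled_ds_RV R n : {RV (unif_sp R n) >-> R})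
        (half_normal_prob (2^-1)%:pos),
      forall x : R, 0 <= x ->
        half_normal_pdf 2^-1 x =
          2 * Num.sqrt 2 / Num.sqrt pi * expR (- (2 * x ^+ 2)),
      exists2 e : nat -> R, e =O_\oo (fun=> 1 : R) &
        \forall n \near \oo,
          ('E_(unif_sp R n)[ds_RV R] =
            (Num.sqrt (n%:R / (2 * pi)) + e n)%:E)%E,
      exists2 e : nat -> R, e =O_\oo (fun n => Num.sqrt n%:R : R) &
        \forall n \near \oo,
          ('V_(unif_sp R n)[ds_RV R] =
            ((1 / 4 - 1 / (2 * pi)) * n%:R + e n)%:E)%E
    & forall k0 : R, k0 < 1 / 2 ->
        exists (C : R) (e1 e2 : nat -> nat -> R),
          \forall n \near \oo, forall k : nat,
            k%:R <= k0 * Num.sqrt (n%:R * ln n%:R) ->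
            [/\ unif_sp R n [set l | ds l = k] =
                  (2 * Num.sqrt 2 / Num.sqrt (pi * n%:R)
                     * expR (- (2 * k%:R ^+ 2 / n%:R))
                   + e1 n k + e2 n k)%:E,
                `|e1 n k| <= C * (k.+1%:R * n%:R `^ (- (3 / 2)))
              & `|e2 n k| <= C * n%:R^-1] ].
Proof.
split.
- by move=> x _; have := @cvg_cdf_scaled_ds R x; rewrite -half_normal_cdfE.
- by move=> x x0; rewrite half_normal_pdfE.
- pose mu n : R := fine ('E_(unif_sp R n)[ds_RV R])%E.
  exists (fun n => mu n - Num.sqrt (n%:R / (2 * pi))).
    apply/eqO_exP; exists 15; first by rewrite ltr0n.
    exists 6%N => // n /= n6.
    have n2 : (2 <= n)%N by lia.
    rewrite normr1 mulr1 /mu {1}(split_semiperimeter n2) expectation_ds.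
    apply: mean_approx; first by lia.
    by rewrite -split_semiperimeter.
  exists 2%N => // n /= n2; rewrite addrC subrK /mu.
  by rewrite (split_semiperimeter n2) expectation_ds.
- pose var n : R := fine ('V_(unif_sp R n)[ds_RV R])%E.
  exists (fun n => var n - (1 / 4 - 1 / (2 * pi)) * n%:R).
    apply/eqO_exP; exists 300; first by rewrite ltr0n.
    exists 6%N => // n /= n6.
    have n2 : (2 <= n)%N by lia.
    rewrite (ger0_norm (sqrtr_ge0 _)) /var {1}(split_semiperimeter n2).
    rewrite variance_ds; last by lia.
    apply: variance_approx => //; first by lia.
    by rewrite -split_semiperimeter.
  exists 6%N => // n /= n6; have n2 : (2 <= n)%N by lia.
  rewrite addrC subrK /var (split_semiperimeter n2) variance_ds //; lia.
move=> k0 k0h.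
pose E n k : R := fine (unif_sp R n [set l | ds l = k]) -
  2 * Num.sqrt 2 / Num.sqrt (pi * n%:R) * expR (- (2 * k%:R ^+ 2 / n%:R)).
pose x n k : R := k.+1%:R * n%:R `^ (- (3 / 2)).
pose y n : R := n%:R^-1.
(* The local law bounds the whole error [E] by [2000 * (x + y)]; splitting it in proportion to [x]
   and [y] bounds each share separately. *)
exists 2000, (fun n k => E n k * (x n k / (x n k + y n))),
  (fun n k => E n k * (y n / (x n k + y n))).
exists 400%N => // n /= n400 k kn.
have n10 : (10 <= n)%N by lia.
have [p [pE pb]] := local_law R n10 (local_law_range n400 k0h kn).
have EE : E n k = p - 2 * Num.sqrt 2 / Num.sqrt (pi * n%:R) *
    expR (- (2 * k%:R ^+ 2 / n%:R)) by rewrite /E pE.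
rewrite -EE -/(x n k) -/(y n) in pb *.
have n0 : 0 < n%:R :> R by rewrite ltr0n; lia.
have x0 : 0 < x n k by rewrite mulr_gt0 ?ltr0n // powR_gt0.
have y0 : 0 < y n by rewrite invr_gt0.
have xy0 : 0 < x n k + y n by rewrite addr_gt0.
split.
- rewrite pE -addrA -mulrDr -mulrDl divff ?lt0r_neq0 // mulr1 EE.
  by rewrite addrC subrK.
- rewrite normrM [X in _ * X]gtr0_norm ?divr_gt0 // mulrA.
  by rewrite ler_pdivrMr // mulrAC ler_wpM2r // ltW.
- rewrite normrM [X in _ * X]gtr0_norm ?divr_gt0 // mulrA.
  by rewrite ler_pdivrMr // mulrAC ler_wpM2r // ltW.
Qed.
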